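(* Let $k\ge 3$ be an integer. There is a set $\mathcal T_k$ of exactly $4k-3$ cyclic permutations of $\{1,\dots,2k+1\}$, none of them equal to the Stefan permutation and with pairwise different digraphs, such that the following hold. (a) If $I$ is a non-degenerate interval of the real line, $f:I\to I$ is continuous, and $\mathbf B=\{\beta_1<\cdots<\beta_{2k+1}\}$ is a second minimal $(2k+1)$-orbit of $f$ that is simple of type $+$, then the cyclic permutation associated with $\mathbf B$ is either the Stefan permutation (i.e. $\mathbf B$ is a Stefan orbit) or an element of $\mathcal T_k$. (b) The inverses of these types represent all second minimal $(2k+1)$-orbits that are simple of type $-$: the cyclic permutation associated with any such orbit is $\omega\circ\pi\circ\omega$, where $\pi$ is either the Stefan permutation or an element of $\mathcal T_k$, and $\omega(i)=2k+2-i$. (c) The orbits with cyclic permutation in $\mathcal T_k$ are simple of type $+$, and the number of elements of $\mathcal T_k$ having each topological structure is as follows: - max: $1$; - min-max: $1$; - min-max-min: $1$; - max-min: $2$; - max-min-max: $2k-3$; - max-min-max-min-max: $2k-5$. The topological structure of the inverse $\omega\circ\pi\circ\omega$ of $\pi\in\mathcal T_k$ is obtained from that of $\pi$ by replacing ''max'' and ''min'' with each other respectively. (d) For each $\pi\in\mathcal T_k$, the $P$-linearization of an orbit with cyclic permutation $\pi$, and likewise the $P$-linearization of an orbit with cyclic permutation $\omega\circ\pi\circ\omega$, is an example of a continuous map with a second minimal $(2k+1)$-orbit, namely that orbit.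
   Context: A point $c\in I$ is periodic with period $m$ if $f^m(c)=c$ and $f^l(c)\ne c$ for $1\le l<m$; the set $\{c,f(c),\dots,f^{m-1}(c)\}$ is then called an $m$-orbit of $f$. Let $\mathbf B=\{\beta_1<\cdots<\beta_m\}$ be an $m$-orbit. Cyclic permutation: the cyclic permutation associated with $\mathbf B$ is the permutation $\pi$ of $\{1,\dots,m\}$ with $f(\beta_i)=\beta_{\pi(i)}$ for all $i$. Digraph: put $J_i=[\beta_i,\beta_{i+1}]$ for $1\le i\le m-1$. The digraph of the orbit (it depends only on $\pi$) has vertices $J_1,\dots,J_{m-1}$ and an edge $J_i\to J_s$ exactly when $J_s$ is contained in the closed interval with endpoints $f(\beta_i)$ and $f(\beta_{i+1})$. Inverse: the inverse digraph is obtained by replacing each $J_i$ by $J_{m-i}$; it is the digraph of the cyclic permutation $\omega\circ\pi\circ\omega$, where $\omega(i)=m+1-i$ is the order-reversing permutation. The permutation $\omega\circ\pi\circ\omega$ is called here the inverse of $\pi$. $P$-linearization: the $P$-linearization of $f$ is the continuous map $P_f:[\beta_1,\beta_m]\to[\beta_1,\beta_m]$ with $P_f(\beta_i)=f(\beta_i)$ for all $i$ and $P_f$ linear on each $J_i$. Topological structure: the topological structure of the orbit (equivalently of $\pi$) is the arrangement of the maximums (''max'') and minimums (''min'') of the map $P_f$ in the open interval $(\beta_1,\beta_m)$. Stefan permutation: the Stefan permutation of $\{1,\dots,2k+1\}$ is $1\mapsto k+1$; $j\mapsto 2k+3-j$ for $2\le j\le k+1$; $j\mapsto 2k+2-j$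 for $k+2\le j\le 2k+1$. A $(2k+1)$-orbit is a Stefan orbit (has Stefan structure) if its cyclic permutation is the Stefan permutation or its inverse. Second minimal orbits: a $(2k+1)$-orbit $\{\beta_1<\cdots<\beta_{2k+1}\}$ of $f$, $k\ge 3$, is called second minimal if $2k-1$ is the minimal period of the restriction $f|_{[\beta_1,\beta_{2k+1}]}$ in the Sharkovski ordering $$1\triangleleft 2\triangleleft 2^2\triangleleft 2^3\triangleleft\cdots\triangleleft 2^2\cdot 5\triangleleft 2^2\cdot 3\triangleleft\cdots\triangleleft 2\cdot 5\triangleleft 2\cdot 3\triangleleft\cdots\triangleleft 9\triangleleft 7\triangleleft 5\triangleleft 3 .$$ This means that $f$ has a periodic orbit of period $2k-1$ contained in $[\beta_1,\beta_{2k+1}]$, and has no periodic orbit contained in $[\beta_1,\beta_{2k+1}]$ whose period is an odd integer $q$ with $1<q<2k-1$. Simple orbits: for $1\le i\le j\le 2k+1$ put $B(i,j)=\{\beta_l : i\le l\le j\}$. A $(2k+1)$-orbit is simple of type $+$ (positive type) if $f$ maps $B(k+2,2k+1)$ into $B(1,k+1)$ and maps all points of $B(1,k+1)$ except one into $B(k+2,2k+1)$. It is simple of type $-$ (negative type) if $f$ maps $B(1,k)$ into $B(k+1,2k+1)$ and maps all points of $B(k+1,2k+1)$ except one into $B(1,k)$.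
   Formalization: Type + (type −) also requires that f maps β_{k+1} into B(k+2,2k+1) (into B(1,k)), since otherwise the types overlap and the count 4k−3 fails; the structure of the inverse is that of π with max and min exchanged and the order reversed (the inverse of a min-max type is again min-max). *)

(* Defs.v *)
From HB Require Import structures.
From mathcomp Require Import all_boot all_order all_algebra all_fingroup.
From mathcomp Require Import all_classical all_reals all_analysis.
From mathcomp Require Import zify.
Set Implicit Arguments.
Unset Strict Implicit.
Unset Printing Implicit Defensive.
Import Order.TTheory GRing.Theory Num.Theory.
Import numFieldNormedType.Exports.

Local Open Scope classical_set_scope.
Local Open Scope ring_scope.

(* Points beta_1 < ... < beta_m are the values of b : 'I_m -> R at 0, ..., m-1,
   and a permutation of {1, ..., m} is an element of 'S_m, shifted likewise. *)

(** ** Permutations *)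

Definition cyclic_perm m (p : 'S_m) : bool := #|porbits p| == 1%N.

Definition omega m : 'S_m := perm (@rev_ord_inj m).

Definition inverse_perm m (p : 'S_m) : 'S_m := (omega m * p * omega m)%g.

(* The zero-based form of 1 |-> k+1, j |-> 2k+3-j for 2 <= j <= k+1, and
   j |-> 2k+2-j for k+2 <= j <= 2k+1. *)
Definition stefan_fun (k : nat) (i : 'I_(2 * k).+1) : 'I_(2 * k).+1 :=
  inord (if i == 0%N :> nat then k
         else if (i <= k)%N then (2 * k + 1 - i)%N else (2 * k - i)%N).

Lemma stefan_fun_inj k : injective (@stefan_fun k).
Proof.
move=> i j /(congr1 val); have := ltn_ord i; have := ltn_ord j.
rewrite /stefan_fun => ltj lti; rewrite /= !inordK;
  first (move=> e; apply/val_inj; move: e => /=);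
  repeat case: ifP; lia.
Qed.

Definition stefan_perm (k : nat) : 'S_(2 * k).+1 := perm (@stefan_fun_inj k).

(* J_i is coded by i : 'I_n, with endpoints of index i and i.+1; J_s lies in
   [beta_u, beta_v] iff u <= s and s.+1 <= v. *)
Definition digraph n (p : 'S_n.+1) : {set 'I_n * 'I_n} :=
  [set e : 'I_n * 'I_n |
     let u := p (widen_ord (leqnSn n) e.1) in
     let v := p (lift ord0 e.1) in
     (minn u v <= e.2)%N && (e.2.+1 <= maxn u v)%N].

(** ** Periodic orbits *)

Section Orbits.
Variable R : realType.
Implicit Types (f g : R -> R) (I D : set R).

(* A continuous self-map of a non-degenerate interval I is represented by a
   total function, whose values outside I are irrelevant. *)
Definition interval_map I f : Prop :=
  [/\ is_interval I, exists x y, [/\ I x, I y & x < y],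
      {within I, continuous f} & forall x, I x -> I (f x)].

Definition has_period f (m : nat) (c : R) : Prop :=
  [/\ (0 < m)%N, iter m f c = c &
      forall l, (1 <= l < m)%N -> iter l f c <> c].

Definition has_orbit_in f D (m : nat) : Prop :=
  exists c, has_period f m c /\ forall l, D (iter l f c).

Definition increasing_points m (b : 'I_m -> R) : Prop :=
  {homo b : i j / (i < j)%N >-> i < j}.

Definition is_orbit f m (b : 'I_m -> R) : Prop :=
  increasing_points b /\
  exists2 c, has_period f m c & range b = [set iter l f c | l in `I_m].

Definition has_perm f m (b : 'I_m -> R) (p : 'S_m) : Prop :=
  forall i, f (b i) = b (p i).

Definition hull n (b : 'I_n.+1 -> R) : set R := `[b ord0, b ord_max].

Definition second_minimal (k : nat) f (b : 'I_(2 * k).+1 -> R) : Prop :=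
  [/\ is_orbit f b, has_orbit_in f (hull b) (2 * k - 1) &
      forall q, odd q -> (1 < q < 2 * k - 1)%N -> ~ has_orbit_in f (hull b) q].

(* B(i, j), with one-based i and j *)
Definition block m (b : 'I_m -> R) (i j : nat) : set R :=
  [set b l | l in [set l : 'I_m | (i <= l.+1 <= j)%N]].

Definition maps_into f (A C : set R) : Prop := forall x, A x -> C (f x).

Definition maps_all_but_one_into f (A C : set R) : Prop :=
  exists x0, [/\ A x0, ~ C (f x0) & forall x, A x -> x <> x0 -> C (f x)].

(* The clauses on B(k+1, k+1) = {beta_{k+1}}: in type + the exceptional point
   is not the midpoint, so that the midpoint moves right; in type - it moves
   left. Without them the types overlap: any orbit satisfying the other two
   clauses of type + whose midpoint is exceptional satisfies those of type -,
   and symmetrically. With them each such orbit has exactly one type, and the type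
   of an orbit changes under conjugation by the order reversal. *)
Definition simple_pos (k : nat) f (b : 'I_(2 * k).+1 -> R) : Prop :=
  [/\ maps_into f (block b (k + 2) (2 * k + 1)) (block b 1 (k + 1)),
      maps_all_but_one_into f (block b 1 (k + 1)) (block b (k + 2) (2 * k + 1)) &
      maps_into f (block b (k + 1) (k + 1)) (block b (k + 2) (2 * k + 1))].

Definition simple_neg (k : nat) f (b : 'I_(2 * k).+1 -> R) : Prop :=
  [/\ maps_into f (block b 1 k) (block b (k + 1) (2 * k + 1)),
      maps_all_but_one_into f (block b (k + 1) (2 * k + 1)) (block b 1 k) &
      maps_into f (block b (k + 1) (k + 1)) (block b 1 k)].

(* At a common endpoint of two of the J_i both choices of i give the same
   value; the value outside [beta_1, beta_m] is irrelevant. *)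
Definition P_linearization f n (b : 'I_n.+1 -> R) (x : R) : R :=
  if [pick i : 'I_n | b (widen_ord (leqnSn n) i) <= x <= b (lift ord0 i)]
  is Some i then
    let u := b (widen_ord (leqnSn n) i) in
    let v := b (lift ord0 i) in
    line_path (f u) (f v) (factor u v x)
  else x.

End Orbits.

(** ** Topological structure *)

Inductive extremum_kind := Max | Min.

Definition bool_of_kind e := if e is Max then true else false.
Definition kind_of_bool (c : bool) := if c then Max else Min.
Lemma bool_of_kindK : cancel bool_of_kind kind_of_bool.
Proof. by case. Qed.
HB.instance Definition _ := Equality.copy extremum_kind (can_type bool_of_kindK).

Definition swap_kind e := if e is Max then Min else Max.

Section TopologicalStructure.
Variable R : realType.

Definition is_extremum (g : R -> R) (x : R) (e : extremum_kind) : Prop :=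
  match e with
  | Max => \forall y \near x, g y <= g x
  | Min => \forall y \near x, g x <= g y
  end.

(* s lists the kinds of all local extrema of g in ]a, c[ from left to right. *)
Definition extrema_arrangement (g : R -> R) (a c : R) (s : seq extremum_kind) :=
  exists xs : seq (R * extremum_kind),
    [/\ sorted <%R [seq z.1 | z <- xs], s = [seq z.2 | z <- xs] &
        forall z, z \in xs <-> a < z.1 < c /\ is_extremum g z.1 z.2].

Definition topological_structure n (p : 'S_n.+1) (s : seq extremum_kind) : Prop :=
  forall (f : R -> R) (b : 'I_n.+1 -> R),
    increasing_points b -> has_perm f b p ->
    extrema_arrangement (P_linearization f b) (b ord0) (b ord_max) s.

Definition count_structure n (T : {set 'S_n.+1}) (s : seq extremum_kind) : nat :=
  #|[set p in T | `[< topological_structure p s >]]|.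

End TopologicalStructure.

(* Main.v *)
(** Label the positions outwards from the midpoint, so that a Stefan orbit visits
    the labels 0, 1, ..., 2k in this order, and let e be the point whose image
    stays on its side. A closed walk of odd length q in the digraph that visits two
    different intervals gives an orbit of odd period d with 1 < d <= q, so for a
    second minimal orbit there is no such walk of length 2k - 3.

    The central interval covers itself, and the hull of it and a point x is
    carried onto a set containing the hull of it and f(x). Hence whenever a label
    is visited later than a larger label of the same parity, the walk from the
    centre to e, which then returns to the centre, is shortened by the difference
    of the two times. In all it can be shortened by at most two steps. So the order
    in which the labels are visited, starting from f(e), is that of a Stefan orbit
    up to the exchange of i and i + 2, and possibly also of i + 1 and i + 3. This
    leaves (2k - 1) + (2k - 2) orbits besides the Stefan one.

    Conversely, for these orbits a height function on the intervals, growing by at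
    most 1 along the edges that do not start next to e, bounds the length of odd
    closed walks below by 2k - 1; and an odd period of the P-linearization that is
    smaller than 2k + 1 gives a closed walk of the same length, because an affine
    map has no orbit of odd period greater than 1. *)

Require Import Defs.
From mathcomp Require Import all_boot all_order all_algebra all_fingroup.
From mathcomp Require Import all_classical all_reals all_analysis.
From mathcomp Require Import zify ring lra.
Set Implicit Arguments.
Unset Strict Implicit.
Unset Printing Implicit Defensive.

(** * Walks *)

Definition walk (e : rel nat) (m i j : nat) : Prop :=
  exists s, [/\ size s = m, path e i s & last i s = j].

(** Two distinct vertices rule out walks that merely repeat a self-covering interval, which may give
    only a fixed point. *)
Definition has_loop (e : rel nat) (q : nat) : Prop :=
  exists s, [/\ size s = q, path.cycle e s &
                exists x y, [/\ x \in s, y \in s & x <> y]].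

Lemma walk0 e i : walk e 0 i i.
Proof. by exists [::]. Qed.

Lemma walk1 (e : rel nat) i j : e i j -> walk e 1 i j.
Proof. by move=> eij; exists [:: j]; rewrite /= eij. Qed.

Lemma walk_cat e m n i j l : walk e m i j -> walk e n j l -> walk e (m + n) i l.
Proof.
move=> [s [<- ps <-]] [t [<- pt <-]]; exists (s ++ t).
by rewrite size_cat cat_path last_cat ps pt.
Qed.

Lemma walk_rcons (e : rel nat) m i j l : walk e m i j -> e j l -> walk e m.+1 i l.
Proof. by move=> wij /walk1 ejl; rewrite -addn1; apply: walk_cat ejl. Qed.

Lemma walk_cons (e : rel nat) m i j l : e i j -> walk e m j l -> walk e m.+1 i l.
Proof. by move=> /walk1 eij wjl; rewrite -add1n; apply: walk_cat wjl. Qed.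

Lemma walk_loop e m n i j : i <> j -> walk e m i j -> walk e n j i ->
  has_loop e (m + n).
Proof.
move=> neq [s [<- ps sj]] [t [<- pt ti]]; exists (s ++ t); split.
- by rewrite size_cat.
- by rewrite (cycle_path i) last_cat sj ti cat_path ps sj.
- exists i, j; split=> //; rewrite mem_cat.
  + case: t ti {pt} => [/= ji|x t <-]; first by case: neq.
    by rewrite /= mem_last orbT.
  + case: s sj {ps} => [/= ji|x s <-]; first by case: neq.
    by rewrite /= mem_last.
Qed.

(* The edge relation of the digraph of P on {0, ..., N}; the vertex i < N is the
   interval with endpoints of index i and i.+1. *)
Definition edge (N : nat) (P : nat -> nat) : rel nat :=
  fun i s => [&& i < N, s < N & minn (P i) (P i.+1) <= s < maxn (P i) (P i.+1)].

(** Discrete intermediate value theorem: if the last interval does not cover [s], then [s] already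
    lies between the images of the endpoints that remain without it. *)
Lemma edge_between N P a b s : a <= b <= N -> s < N ->
  minn (P a) (P b) <= s < maxn (P a) (P b) ->
  exists2 r, a <= r < b & edge N P r s.
Proof.
elim: b => [|b IHb] /andP[ab bN] sN sP.
  by move: ab sP; rewrite leqn0 => /eqP->; lia.
have [ba|ab1] := leqP a b; last by move: sP; rewrite (_ : a = b.+1); lia.
case: (boolP (edge N P b s)) => [ebs|nbs]; first by exists b => //; lia.
rewrite /edge bN sN /= in nbs.
have [r rab ers] : exists2 r, a <= r < b & edge N P r s by apply: IHb; lia.
by exists r => //; lia.
Qed.

Lemma edge_lt N P i s : edge N P i s -> i < N /\ s < N.
Proof. by case/and3P. Qed.

(** * Labels *)

(* Positions 0, ..., 2 * k are labelled outwards from the midpoint k, even labels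
   on its left and odd labels on its right; [pos k] inverts [lab k]. Along a
   Stefan orbit the label increases by 1 at each step. *)
Definition lab (k x : nat) : nat := if x <= k then 2 * (k - x) else 2 * (x - k) - 1.

Definition pos (k m : nat) : nat := if odd m then k + uphalf m else k - m./2.

Lemma labP k x : x <= k /\ lab k x = 2 * (k - x) \/ k < x /\ lab k x + 1 = 2 * (x - k).
Proof. by rewrite /lab; case: leqP; lia. Qed.

Lemma posP k m : odd m /\ 2 * pos k m = 2 * k + m + 1 \/
  ~~ odd m /\ pos k m = k - m./2 /\ m = 2 * m./2.
Proof. by rewrite /pos; case: ifP; lia. Qed.

Lemma labK k x : x <= 2 * k -> pos k (lab k x) = x.
Proof. by have := labP k x; have := posP k (lab k x); lia. Qed.

Lemma posK k m : m <= 2 * k -> lab k (pos k m) = m.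
Proof. by have := labP k (pos k m); have := posP k m; lia. Qed.

Lemma lab_leq k x : x <= 2 * k -> lab k x <= 2 * k.
Proof. by have := labP k x; lia. Qed.

Lemma pos_leq k m : m <= 2 * k -> pos k m <= 2 * k.
Proof. by have := posP k m; lia. Qed.

Lemma odd_lab k x : odd (lab k x) = (k < x).
Proof. by have := labP k x; lia. Qed.

Lemma pos_odd k m : m <= 2 * k -> (k < pos k m) = odd m.
Proof. by move=> mN; have := posP k m; lia. Qed.

Lemma ltn_lab_left k x y : x <= k -> y <= k -> (lab k x < lab k y) = (y < x).
Proof. by move=> xk yk; rewrite /lab xk yk; lia. Qed.

Lemma ltn_lab_right k x y : k < x -> k < y -> (lab k x < lab k y) = (x < y).
Proof. by move=> kx ky; rewrite /lab (leqNgt x) (leqNgt y) kx ky /=; lia. Qed.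

(** * Almost increasing sequences *)

(* The orbits of the types visit the labels of a Stefan orbit in an order
   changed by such an involution. *)
Definition swap (b : bool) (i t : nat) : nat :=
  if (t == i) || b && (t == i.+1) then t.+2
  else if (t == i.+2) || b && (t == i.+3) then t - 2 else t.

Section AlmostIncreasing.
Variables (n : nat) (g : nat -> nat).
Hypothesis g_inj : forall t u, t <= n -> u <= n -> g t = g u -> t = u.
Hypothesis g_onto : forall v, v <= n -> exists2 t, t <= n & g t = v.
Hypothesis g_odd : forall t, t <= n -> odd (g t) = odd t.
Hypothesis g_inv : forall t u, t < u <= n -> odd t = odd u -> g u < g t -> u = t.+2.
Hypothesis g_chain : forall t u, t.+2 <= u -> u.+2 <= n ->
  g t.+2 < g t -> g u.+2 < g u -> False.

(** Within one parity only neighbours [t] and [t.+2] can be inverted, so the bijection is a product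
    of disjoint exchanges of neighbours. *)
Lemma almost_increasing_step t : t <= n ->
  [\/ g t = t,
      t.+2 <= n /\ g t = t.+2 /\ g t.+2 = t |
      exists2 s, t = s.+2 & g s = t /\ g t = s].
Proof.
elim/ltn_ind: t => t IHt tn.
have [/andP[t2 /eqP gt2]|nost] := boolP ((2 <= t) && (g (t - 2) == t)).
  apply: Or33; exists (t - 2); first lia.
  have tt : (t - 2).+2 = t by lia.
  case: (IHt (t - 2)) => [| |gt|[_ [_]]|[s st [gs gt]]]; rewrite ?tt; lia.
(* Since [t] is not the second half of an exchange, the earlier times of its parity fill exactly the
   values of that parity below [t]. *)
have small s : s < t -> odd s = odd t -> g s < t.
  move=> st odds; have sn : s <= n by lia.
  case: (IHt s st sn) => [-> //|[_ [gs _]]|[r sr [_ gs]]]; last lia.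
  have [e|] := eqVneq s (t - 2); last lia.
  by move: nost; rewrite -e gs; lia.
have attained v : v < t -> odd v = odd t -> exists2 s, s < t & g s = v.
  move=> vt oddv; have vn : v <= n by lia.
  case: (IHt v vt vn) => [gv|[_ [gv gv2]]|[r rv [gr _]]].
  - by exists v.
  - exists v.+2 => //; have := small _ vt oddv; lia.
  - by exists r; lia.
have large u : t <= u -> u <= n -> odd u = odd t -> t <= g u.
  move=> tu un oddu; rewrite leqNgt; apply/negP => gut.
  have := g_odd un; case: (attained (g u)) => //; first by rewrite g_odd.
  by move=> s st gsu; have := g_inj (_ : s <= n) un gsu; lia.
have [u un gu] := g_onto tn.
have oddu : odd u = odd t by rewrite -(g_odd un) gu.
have tu : t <= u by rewrite leqNgt; apply/negP => /small/(_ oddu); lia.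
have gtt := large t (leqnn t) tn erefl.
have [e|ut] := eqVneq u t; first by apply: Or31; rewrite -[in RHS]gu e.
have gtne : g t <> t by move=> e; have := g_inj tn un; lia.
have u2 : u = t.+2 by apply: g_inv; lia.
have tn2 : t.+2 <= n by rewrite -u2.
(* If the value [t.+2] were taken at a time [v] other than [t], then [g t > t.+2] would invert [t]
   and [v], forcing [v = u]. *)
have [v vn gv] := g_onto tn2.
have oddv : odd v = odd t by rewrite -(g_odd vn) gv /= negbK.
have tv : t <= v by rewrite leqNgt; apply/negP => /small/(_ oddv); lia.
apply: Or32; split=> //; split; last by rewrite -u2.
have [vt|vt] := eqVneq v t; first by rewrite -[in LHS]vt.
have vu : v <> u by move=> e; move: gv; rewrite e gu; lia.
have gt2 : g t <> t.+2 by move=> e; have := g_inj tn vn; lia.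
have oddg := g_odd tn.
have gt_large : t.+2 < g t by clear - gtt gtne gt2 oddg; lia.
case: vu; rewrite u2; apply: g_inv; last by rewrite gv.
  by rewrite ltn_neqAle eq_sym vt tv vn.
by rewrite oddv.
Qed.

(** With [i] the first exchange, [g_chain] leaves room only for another one at [i.+1]; [b] records
    whether it occurs. *)
Lemma almost_increasing_swap :
  (forall t, t <= n -> g t = t) \/
  (exists (b : bool) i, i.+2 + b <= n /\ forall t, t <= n -> g t = swap b i t).
Proof.
have [/existsP[j0 j0P]|none] := boolP [exists j : 'I_n.+1, (j.+2 <= n) && (g j == j.+2)];
  last first.
  left; elim/ltn_ind => t IHt tn.
  case: (almost_increasing_step tn) => [//|[tn2 [gt _]]|[s ts [gs _]]].
  - case/existsP: none; have tN : t < n.+1 by lia.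
    by exists (Ordinal tN) => /=; rewrite tn2 gt eqxx.
  - case/existsP: none; have sN : s < n.+1 by lia.
    by exists (Ordinal sN) => /=; rewrite gs; lia.
right.
pose D j := (j.+2 <= n) && (g j == j.+2).
have exD : exists j, D j by exists j0.
have [i /andP[in2 /eqP gi] imin] := ex_minnP exD.
have D2 j : D j -> g j.+2 = j.
  case/andP=> jn /eqP gj; have jn' : j <= n by lia.
  by case: (almost_increasing_step jn') => [|[_ []]|[s sj []]]; lia.
have gi2 : g i.+2 = i by apply: D2; rewrite /D gi eqxx andbT.
have Dbound j : D j -> i <= j <= i.+1.
  move=> Dj; rewrite imin //=; rewrite leqNgt; apply/negP => ij.
  have gj2 := D2 _ Dj; case/andP: Dj => jn /eqP gj.
  by apply: (@g_chain i j); lia.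
exists (D i.+1), i; split; first by case: (boolP (D _)) => [/andP[]|]; lia.
move=> t tn; rewrite /swap.
have DE j : D j = (j == i) || D i.+1 && (j == i.+1).
  apply/idP/idP => [Dj|/orP[/eqP->|/andP[? /eqP->//]]].
    have [->//|ji] := eqVneq j i; have := Dbound _ Dj => jb.
    by rewrite -(_ : j = i.+1) ?Dj ?eqxx //; lia.
  by rewrite /D gi eqxx andbT.
rewrite -DE; have -> : (t == i.+2) || D i.+1 && (t == i.+3) = (1 < t) && D (t - 2).
  by case: t tn => [|[|t]] tn; rewrite /= ?andbF //= (DE (_ - 2)) subn2 /= !eqSS.
case: ifP => [/andP[_ /eqP//]|Dt]; case: ifP => [/andP[t1 /D2]|Dt2].
  by rewrite (_ : (t - 2).+2 = t) //; lia.
case: (almost_increasing_step tn) => [//|[tn2 [gt _]]|[s ts [gs _]]].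
  by move: Dt; rewrite /D tn2 gt eqxx.
by move: Dt2; rewrite ts subn2 /= /D gs -ts tn eqxx.
Qed.

End AlmostIncreasing.

(** * Walks in the digraph of a simple orbit of type + *)

Section SimpleMap.
Variables (k : nat) (P : nat -> nat) (e : nat).
Let N := 2 * k.
Hypothesis ek : e < k.
Hypothesis Pe : P e <= k.
Hypothesis Pright : forall j, k < j <= N -> P j <= k.
Hypothesis Pleft : forall j, j <= k -> j <> e -> k < P j <= N.

Local Notation E := (edge N P).

(** The range of [s] is the hull of [x] and the central interval [k]. The walks have length exactly
    [m], but the centre covers itself, so they may wait there. *)
Definition reach (m x : nat) : Prop :=
  forall s, minn x k <= s < maxn x k.+1 -> walk E m k s.

Lemma reach0k : reach 0 k.
Proof. by move=> s sk; rewrite (_ : s = k); [exact: walk0 | lia]. Qed.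

Lemma edge_center : E k k.
Proof.
have := Pleft (leqnn k); have := @Pright k.+1.
by rewrite /edge /N; lia.
Qed.

Lemma reach_wait m x : reach m x -> reach m.+1 x.
Proof. by move=> rx s /rx; apply: walk_cons edge_center. Qed.

Lemma reach_leq m n x : m <= n -> reach m x -> reach n x.
Proof.
move=> /subnK <-; elim: (n - m) => // d IHd rx.
by rewrite addSn; apply/reach_wait/IHd.
Qed.

Lemma reach_inner m x y : reach m x -> x <= y <= k \/ k < y <= x -> reach m y.
Proof. by move=> rx xy s sy; apply: rx; lia. Qed.

(* P carries x across the midpoint and one end of the central interval back, so
   the intervals between them cover those between P x and the centre. *)
Lemma reachS m x : reach m x -> x <= N -> x <> e -> reach m.+1 (P x).
Proof.
move=> rx xN xe s sP.
have [xk|kx] := leqP x k.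
- have Px := Pleft xk xe; have Pk1 := @Pright k.+1.
  have [|||r rx' ers] := @edge_between N P x k.+1 s; rewrite /N in Px xN *; try lia.
  by apply: walk_rcons ers; apply: rx; lia.
- have Px := @Pright x; have Pk := Pleft (leqnn k).
  have [|||r rx' ers] := @edge_between N P k x s; rewrite /N in Px xN Pk *; try lia.
  by apply: walk_rcons ers; apply: rx; lia.
Qed.

(** The interval [e] covers the centre because [P e <= k < P e.+1], so one more edge closes the
    walk. *)
Lemma reach_loop m : reach m e -> has_loop E m.+1.
Proof.
move=> re; rewrite -addn1.
apply: (@walk_loop _ _ _ k e); first lia.
  by apply: re; lia.
apply: walk1.
have := @Pleft e.+1; rewrite /edge /N; lia.
Qed.

(* The walks that leave the intervals between P e and k to the right. One that
   ends at an interval next to e closes up (linked_loop), because such an interval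
   covers all those between P e and k. *)
Definition linked (m x y : nat) : Prop :=
  forall s, minn x y <= s < maxn x y ->
    exists j r, [/\ P e <= j < k, k < r, E j r & walk E m r s].

Lemma linkedS m x y : x <= N -> y <= N -> linked m x y ->
  linked m.+1 (P x) (P y).
Proof.
move=> xN yN lxy s sP.
have PN j : j <= N -> P j <= N.
  have := Pright (j := j); have := Pleft (j := j).
  by case: (eqVneq j e) => [->|/eqP] ; rewrite /N; lia.
have := PN _ xN; have := PN _ yN => PyN PxN.
have [r rxy ers] : exists2 r, minn x y <= r < maxn x y & E r s.
  have [xy|yx] := leqP x y.
    by have [|||r rxy ers] := @edge_between N P x y s; try lia; exists r => //; lia.
  by have [|||r rxy ers] := @edge_between N P y x s; try lia; exists r => //; lia.
have [j [t [jk kt ejt wtr]]] := lxy _ rxy.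
by exists j, t; split=> //; apply: walk_rcons ers.
Qed.

Lemma linked_loop m x : x <= k -> x <> e -> linked m e x -> has_loop E m.+2.
Proof.
move=> xk xe lex.
(* The interval at [e] on the side of [x]: it lies between [e] and [x], so a walk to it is
   available. *)
pose r := if x < e then e.-1 else e.
have [|j [t [jk kt ejt wtr]]] := lex r; first by rewrite /r; case: ifP; lia.
have erj : E r j.
  have Px := Pleft xk xe; have Per := @Pleft r; have Per1 := @Pleft r.+1.
  have re : (r = e \/ r.+1 = e) /\ r < k by rewrite /r; case: ifP; lia.
  rewrite /edge; case: re => [[re|re]] rk; rewrite re /N in Per Per1 *; lia.
rewrite -(add1n m.+1); apply: (@walk_loop _ _ _ j t); first lia.
  exact: walk1.
exact: walk_rcons erj.
Qed.

(** Time 0 is the image of the exceptional point, so a cyclic [P] is back at [e] at time [2 * k]. *)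
Definition visit (t : nat) : nat := iter t.+1 P e.
Hypothesis visit_inj : forall t u, t <= N -> u <= N -> visit t = visit u -> t = u.
Hypothesis visit_onto : forall x, x <= N -> exists2 t, t <= N & visit t = x.
Hypothesis visit_last : visit N = e.
Hypothesis noloop : ~ has_loop E (N - 3).
Hypothesis k3 : 3 <= k.

Local Notation g := (fun t => lab k (visit t)).

Lemma visitS t : visit t.+1 = P (visit t).
Proof. by []. Qed.

Lemma visit_leq t : visit t <= N.
Proof.
elim: t => [|t]; first by rewrite /visit /= /N; lia.
rewrite visitS.
case: (eqVneq (visit t) e) => [->|/eqP]; first by rewrite /N; lia.
have := Pright (j := visit t); have := Pleft (j := visit t); rewrite /N; lia.
Qed.

Lemma visit_neq t : t < N -> visit t <> e.
Proof. by move=> tN; rewrite -visit_last => /visit_inj; lia. Qed.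

Lemma visit_odd t : t <= N -> (k < visit t) = odd t.
Proof.
elim: t => [|t IHt] tN; first by rewrite /visit /=; lia.
have := visit_neq tN; have := visit_leq t; have := IHt (ltnW tN).
rewrite visitS /= => <-.
have := Pright (j := visit t); have := Pleft (j := visit t); rewrite /N; lia.
Qed.

Lemma reach_visit m t u : t <= u <= N -> reach m (visit t) ->
  reach (m + (u - t)) (visit u).
Proof.
move=> /andP[/subnKC <-]; elim: (u - t) => [|d IHd] tN rt.
  by rewrite addn0 subnn addn0.
rewrite addnS subSn ?leq_addr // addnS visitS.
apply: reachS; first by apply: IHd => //; lia.
  exact: visit_leq.
by apply: visit_neq; lia.
Qed.

(** From [visit t] the orbit needs [N - t] steps to [e]. Being four steps early at [visit t] would
    close a loop within [N - 3] steps, and waiting at the centre makes the length exact. *)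
Lemma reach_late m t : t <= N -> reach m (visit t) -> t < m + 4.
Proof.
move=> tN rt; rewrite ltnNge; apply/negP => mt; apply: noloop.
have := reach_visit (_ : t <= N <= N) rt; rewrite tN leqnn visit_last => /(_ isT) re.
rewrite (_ : N - 3 = (N - 4).+1); last by rewrite /N; lia.
by apply: reach_loop; apply: reach_leq re; lia.
Qed.

Lemma reach_lab m t u : t <= N -> u <= N -> odd t = odd u -> g u <= g t ->
  reach m (visit t) -> reach m (visit u).
Proof.
move=> tN uN otu gut rt; apply: reach_inner rt _.
have := visit_odd tN; have := visit_odd uN; rewrite otu.
have := labP k (visit t); have := labP k (visit u); lia.
Qed.

Lemma linked_visit d m t u : linked m (visit t) (visit u) ->
  linked (m + d) (visit (t + d)) (visit (u + d)).
Proof.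
move=> ltu; elim: d => [|d IHd]; first by rewrite !addn0.
by rewrite !addnS !visitS; apply: linkedS; rewrite ?visit_leq.
Qed.

(** Following both points for [N - 5] steps ends at [e] and another left point; closing up takes two
    more edges, in all the forbidden length [N - 3]. *)
Lemma not_linked : ~ linked 0 (visit 5) (visit 3).
Proof.
move=> /(@linked_visit (N - 5)).
have -> : 5 + (N - 5) = N by rewrite /N; lia.
have -> : 3 + (N - 5) = N - 2 by rewrite /N; lia.
rewrite visit_last => /linked_loop lk; apply: noloop.
have -> : N - 3 = (0 + (N - 5)).+2 by rewrite /N; lia.
have N2 : N - 2 < N by rewrite /N; lia.
apply: lk; last exact: visit_neq.
have := visit_odd (ltnW N2).
have -> : odd (N - 2) = false by rewrite /N; lia.
lia.
Qed.

Lemma visit_label_swap :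
  (forall t, t <= N -> g t = t) \/
  (exists (b : bool) i, i.+2 + b <= N /\ forall t, t <= N -> g t = swap b i t).
Proof.
(* The midpoint is visited at an even time [t0 < 4], hence 0 or 2. From then on [visit t] is reached
   in [t - t0] steps. *)
have [t0 t0N vt0] : exists2 t, t <= N & visit t = k by apply: visit_onto; rewrite /N; lia.
have r0 t : t0 <= t <= N -> reach (t - t0) (visit t).
  move=> t0t; rewrite -[t - t0]add0n; apply: reach_visit => //.
  by rewrite vt0; exact: reach0k.
have t0_lt4 : t0 < 4.
  by rewrite -[4]add0n; apply: reach_late => //; rewrite vt0; exact: reach0k.
have t0_odd : odd t0 = false by rewrite -(visit_odd t0N) vt0 ltnn.
have late t u : t0 <= t <= N -> u <= N -> odd t = odd u -> g u < g t ->
    u < t - t0 + 4.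
  move=> t0t uN otu gut; apply: reach_late => //.
  by apply: (reach_lab _ uN otu (ltnW gut)); [lia | exact: r0].
have g_odd t : t <= N -> odd (g t) = odd t by move=> tN; rewrite odd_lab visit_odd.
have g_inj t u : t <= N -> u <= N -> g t = g u -> t = u.
  move=> tN uN /(congr1 (pos k)); rewrite !labK ?visit_leq //; exact: visit_inj.
have g_inv t u : t < u <= N -> odd t = odd u -> g u < g t -> u = t.+2.
  case/andP=> tu uN otu gut.
  (* For [t0 <= t], [late] and parity leave only [t.+2]. Otherwise [t0 = 2] and [t] is 0 or 1, and
     the contradiction comes from [not_linked]. *)
  have [tt0|t_lt] := leqP t0 t; first by have := late t u; lia.
  apply/eqP; apply/negPn/negP => ut; case: not_linked.
  have t02 : t0 = 2 by clear - t0_lt4 t0_odd t_lt; lia.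
  have v2 : visit 2 = k by rewrite -vt0 t02.
  (* The start at time 2 already saves two steps, so no inversion is left from there on. *)
  have mono m n : 2 <= m < n -> n <= N -> odd m = odd n -> g m < g n.
    case/andP=> m2 mn nN omn; have mN := leq_trans (ltnW mn) nN.
    rewrite ltn_neqAle; apply/andP; split.
      by apply/eqP => /(g_inj _ _ mN nN) mnE; rewrite mnE ltnn in mn.
    rewrite leqNgt; apply/negP => /(late _ _ _ nN omn); rewrite t02 m2 mN => /(_ isT).
    have : odd n <> odd m.+1 by rewrite /= -omn; case: (odd m).
    by clear - m2 mn; case: (eqVneq n m.+1) => [->|]; lia.
  have N6 : 6 <= N by rewrite /N; lia.
  have v0k : visit 0 <= k by rewrite leqNgt visit_odd.
  have v4k : visit 4 <= k by rewrite leqNgt visit_odd //; lia.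
  have kv1 : k < visit 1 by rewrite visit_odd //; lia.
  have kv3 : k < visit 3 by rewrite visit_odd //; lia.
  have kv5 : k < visit 5 by rewrite visit_odd //; lia.
  have v35 : visit 3 < visit 5 by rewrite -(ltn_lab_right kv3 kv5); apply: mono => //; lia.
  (* Here [u >= t + 4], so [visit 4] (for [t = 0]) or [visit 5] (for [t = 1]) is nearer to the
     midpoint than [visit t]. Either way some point between [P e] and [k] has its image at or beyond
     [visit 5]. *)
  have [x /andP[xPe xk] xv] : exists2 x, P e <= x <= k & visit 5 <= P x.
    have [e0|e1] : t = 0 \/ t = 1 by lia.
    - have g4 : g 4 <= g u.
        by have [->//|u4] := eqVneq u 4; apply/ltnW/mono => //; lia.
      exists (visit 4) => //; rewrite v4k andbT.
      apply: ltnW; rewrite -[P e]/(visit 0) -(ltn_lab_left v4k v0k).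
      by apply: leq_ltn_trans g4 _; move: gut; rewrite e0.
    - have g5 : g 5 <= g u.
        by have [->//|u5] := eqVneq u 5; apply/ltnW/mono => //; lia.
      exists (P e); first by rewrite leqnn.
      apply: ltnW; rewrite -[P (P e)]/(visit 1) -(ltn_lab_right kv5 kv1).
      by apply: leq_ltn_trans g5 _; move: gut; rewrite e1.
  have Pk : P k = visit 3 by rewrite -v2.
  have vN := visit_leq 5.
  (* As [P k = visit 3], the intervals from [x] to [k] cover all those between [visit 3] and
     [visit 5]. *)
  clear mono late g_odd g_inj r0 gut; move=> s s53.
  have [|||j jx ejs] := @edge_between N P x k s; rewrite ?Pk; [|lia|lia|].
    by rewrite xk /N leq_pmull.
  by exists j, s; split; [lia|lia|exact: ejs|exact: walk0].
have g_chain t u : t.+2 <= u -> u.+2 <= N -> g t.+2 < g t -> g u.+2 < g u -> False.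
  move=> tu uN gt gu.
  (* Each inversion saves two steps, and so does the start [t0 = 2]. Two inversions, or one and this
     start, save four, which [reach_late] forbids. *)
  have [tt0|tt0] := leqP t0 t; last by have := late u u.+2; rewrite /= negbK; lia.
  have rt : reach (t - t0) (visit t.+2).
    by apply: (@reach_lab _ t); rewrite /= ?negbK //; [lia|lia|exact: ltnW|apply: r0; lia].
  have ru : reach (t - t0 + (u - t.+2)) (visit u) by apply: reach_visit rt; lia.
  have : u.+2 < t - t0 + (u - t.+2) + 4.
    apply: reach_late => //.
    by apply: (reach_lab _ _ _ (ltnW gu) ru); rewrite /= ?negbK //; lia.
  lia.
apply: almost_increasing_swap => //.
move=> v vN; have [t tN vt] := visit_onto (pos_leq vN).
by exists t => //; rewrite vt posK.
Qed.
End SimpleMap.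

(** * Orbits in swapped order *)

Definition cnext (k t : nat) : nat := if t < 2 * k then t.+1 else 0.

(* The orbit with this map visits the labels swap b i 0, swap b i 1, ... in turn. *)
Definition swap_map (k : nat) (b : bool) (i x : nat) : nat :=
  pos k (swap b i (cnext k (swap b i (lab k x)))).

Lemma cnext_leq k t : cnext k t <= 2 * k.
Proof. by rewrite /cnext; case: ifP. Qed.

Lemma swapP (b : bool) i t :
  (i <= t <= i + b /\ swap b i t = t + 2) \/
  (i + 2 <= t <= i + b + 2 /\ swap b i t + 2 = t) \/
  (t < i \/ i + b < t) /\ (t < i + 2 \/ i + b + 2 < t) /\ swap b i t = t.
Proof. by rewrite /swap; case: b => /=; repeat case: ifP; lia. Qed.
Lemma path_flip (side : pred nat) x s :
  path [rel x y | side y == ~~ side x] x s -> side (last x s) = side x (+) odd (size s).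
Proof.
elim: s x => [|y s IHs] x /=; first by rewrite addbF.
by case/andP=> /eqP yx /IHs ->; rewrite yx addNb addbN.
Qed.

(** Every edge changes the side and the walk returns to where it started. *)
Lemma cycle_flip (side : pred nat) s :
  path.cycle [rel x y | side y == ~~ side x] s -> ~~ odd (size s).
Proof.
rewrite (cycle_path 0) => /path_flip.
by case: s => [|x s] //=; case: (side _); case: (odd _).
Qed.

Section SwapMap.
Variables (k : nat) (b : bool) (i : nat).
Hypothesis k3 : 3 <= k.
Hypothesis ib : i.+2 + b <= 2 * k.
Let N := 2 * k.
Notation P := (swap_map k b i).
(** The position visited at time [2 * k], the last before the orbit closes. *)
Definition swap_exc := pos k (swap b i (2 * k)).
Notation e := swap_exc.

Lemma swapK t : swap b i (swap b i t) = t.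
Proof. by clear; rewrite /swap; case: b => /=; repeat case: ifP; lia. Qed.

Lemma odd_swap t : odd (swap b i t) = odd t.
Proof. by clear; rewrite /swap; case: b => /=; repeat case: ifP; lia. Qed.

Lemma swap_leq t : t <= N -> swap b i t <= N.
Proof. by move: ib; rewrite /swap /N; case: b => /=; repeat case: ifP; lia. Qed.

Lemma swap_exc_lt : e < k.
Proof.
move: ib; rewrite /swap_exc /swap; have := posP k (swap b i (2 * k)); rewrite /swap.
by case: b => /=; repeat case: ifP; lia.
Qed.

Lemma swap_map_pos t : t <= N -> P (pos k (swap b i t)) = pos k (swap b i (cnext k t)).
Proof. by move=> tN; rewrite /swap_map posK ?swap_leq // swapK. Qed.

Lemma swap_map_exc : P e = pos k (swap b i 0).
Proof. by rewrite swap_map_pos // /cnext ltnn. Qed.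

Lemma swap_map_leq x : x <= N -> P x <= N.
Proof. by move=> xN; rewrite pos_leq ?swap_leq ?cnext_leq. Qed.

Lemma swap_lab_neq x : x <= N -> x <> e -> swap b i (lab k x) < N.
Proof.
move=> xN xe; rewrite ltn_neqAle swap_leq ?lab_leq // andbT; apply/eqP => sx; case: xe.
by rewrite /swap_exc -/N -sx swapK labK.
Qed.

Lemma swap_map_side x : x <= N -> x <> e -> (k < P x) = (x <= k).
Proof.
move=> xN xe; rewrite pos_odd ?swap_leq ?cnext_leq // odd_swap.
have lt := swap_lab_neq xN xe.
by rewrite /cnext lt /= odd_swap odd_lab -leqNgt.
Qed.

(* The label of the outer endpoint of the interval s. *)
Definition ilab s := if s < k then 2 * (k - s) else (2 * (s - k)).+1.

(* The exchange of i and i.+2 saves two steps of a walk from the centre. *)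
Definition height m := if m <= i.+1 then m else m - 2.

Lemma leq_height m n : m <= n -> odd m = odd n \/ m = 0 -> height m <= height n.
Proof. by rewrite /height; do 2 case: ifP; lia. Qed.

(** The only upward jumps of the label by more than 1 are jumps by 3 into or out of the exchanged
    labels, across the threshold [i.+1]; the subtracted 2 turns them into steps of 1. *)
Lemma height_step m : swap b i m < N -> height (swap b i (swap b i m).+1) <= (height m).+1.
Proof.
move=> _; have := swapP b i m; have := swapP b i (swap b i m).+1.
by rewrite /height; case: b; do 2 case: ifP; lia.
Qed.

(** The images of the endpoints of [s] enclose [s'], so one of them lies at or beyond its outer
    endpoint. *)
Lemma edge_ilab Q s s' : edge N Q s s' -> exists x,
  [/\ x = s \/ x = s.+1, ilab s' <= lab k (Q x) & odd (ilab s') = odd (lab k (Q x))].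
Proof.
case/and3P => _ _ Qs; rewrite /ilab; case: ltnP => s'k.
  have [x xs xQ] : exists2 x, x = s \/ x = s.+1 & Q x <= s'.
    by have [h|h] := leqP (Q s) s'; [exists s => //; left|exists s.+1; [right|lia]].
  exists x; split=> //; first by rewrite /lab; case: ifP; lia.
  by rewrite odd_lab mul2n odd_double; lia.
have [x xs xQ] : exists2 x, x = s \/ x = s.+1 & s' < Q x.
  by have [h|h] := leqP (Q s) s'; [exists s.+1; [right|lia]|exists s => //; left].
exists x; split=> //; first by rewrite /lab; case: ifP; lia.
by rewrite odd_lab mul2n /= odd_double; lia.
Qed.

Lemma ilab_lab s x : x = s \/ x = s.+1 ->
  lab k x <= ilab s /\ (odd (lab k x) = odd (ilab s) \/ lab k x = 0).
Proof.
rewrite odd_lab /lab /ilab => -[->|->]; repeat case: ifP; lia.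
Qed.

Lemma edge_height s s' : edge N P s s' -> s <> e -> s.+1 <> e ->
  height (ilab s') <= (height (ilab s)).+1.
Proof.
move=> ess' se se1; have [x [xs le_s' odd_s']] := edge_ilab ess'.
have [sN _] := edge_lt ess'.
have xe : x <> e by case: xs => ->.
have xN : x <= N by case: xs => ->; lia.
have [les ods] := ilab_lab xs.
apply: leq_trans (leq_height le_s' (or_introl odd_s')) _.
have lt := swap_lab_neq xN xe.
rewrite /swap_map /cnext lt posK ?swap_leq //.
by apply: leq_trans (height_step lt) _; rewrite ltnS leq_height.
Qed.

Lemma edge_side s s' : edge N P s s' -> s <> e -> s.+1 <> e -> s <> k ->
  s' <> k /\ (s' < k) = ~~ (s < k).
Proof.
case/and3P => sN _ Pss' se se1 sk.
have := swap_map_side (ltnW sN) se; have := swap_map_side sN se1.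
by move: (P s) (P s.+1) Pss' => p p1; lia.
Qed.

Lemma swap_exc_side s : s = e \/ s.+1 = e -> s < k.
Proof. by have := swap_exc_lt; lia. Qed.

(** Only [i = 0] puts [P e] left of the midpoint, namely at [k.-1], while the other endpoint of [s]
    maps to the right. *)
Lemma edge_exc s s' : edge N P s s' -> s = e \/ s.+1 = e -> s' < k ->
  i = 0 /\ s' = k.-1.
Proof.
case/and3P => sN _ Pss' se s'k.
have ek := swap_exc_lt; have := swap_exc_side se => sk.
have Pe : P e = if i == 0 then k.-1 else k.
  rewrite swap_map_exc; case: eqVneq => [->|i0].
    by rewrite /swap /pos /= subn1.
  by rewrite /swap /pos eq_sym (negPf i0) andbF /= subn0.
have side x : x <= k -> x <> e -> k < P x.
  by move=> xk xe; rewrite swap_map_side // /N; lia.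
move: Pss'; case: se => se; rewrite se; last rewrite -[s]/(s).
  have := side e.+1; rewrite Pe; case: eqP => i0; lia.
have := side s; rewrite Pe; case: eqP => i0; lia.
Qed.

Definition exc s := (s == e) || (s.+1 == e).

Lemma height_exc s : exc s -> s < N -> N - 2 <= height (ilab s).
Proof.
have ek := swap_exc_lt; move=> se sN.
have : ilab s = lab k e \/ ilab s = (lab k e).+2.
  by move: se; rewrite /exc /lab /ilab; case/orP=> /eqP se; repeat case: ifP; lia.
have := ib; have : ilab s <= N by rewrite /ilab /N; case: ifP; lia.
rewrite /swap_exc posK ?swap_leq // /height /swap -/N.
by case: b => /=; repeat case: ifP; rewrite /N; lia.
Qed.

Lemma path_height x s : x < N -> path (edge N P) x s -> has exc (x :: s) ->
  N - 2 <= height (ilab x) + size s.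
Proof.
elim: s x => [|y s IHs] x xN /=; first by rewrite orbF => _ /height_exc/(_ xN); lia.
case/andP=> exy pys; case: (boolP (exc x)) => [/height_exc/(_ xN)|/norP[/eqP xe /eqP x1e] hs].
  by lia.
have [_ yN] := edge_lt exy.
by have := IHs _ yN pys hs; have := edge_height exy xe x1e; lia.
Qed.

Lemma path_center x s : path (edge N P) x s -> last x s = k -> ~~ has exc (x :: s) ->
  all (pred1 k) (x :: s).
Proof.
elim: s x => [|y s IHs] x /=; first by move=> _ ->; rewrite eqxx.
case/andP=> exy pys lk /norP[/norP[/eqP xe /eqP x1e] hs].
have /= /andP[/eqP yk ->] := IHs _ pys lk hs.
rewrite yk eqxx !andbT; apply/eqP/eqP/negPn/negP => /eqP xk.
by have [] := edge_side exy xe x1e xk.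
Qed.

(** Sides alternate along a loop unless it meets the centre, or, for [i = 0], goes from an interval
    next to [e] to [k.-1]. Rotated to start there, it has initial height 1 or 0 and must climb to
    [N - 2] next to [e]. *)
Lemma swap_loop_leq q : odd q -> has_loop (edge N P) q -> N - 1 <= q.
Proof.
move=> oddq [s [sq cs [x [y [xs ys xy]]]]].
(* [N - 2] is even and [q] is odd, so the weaker bound suffices. *)
suff : N - 2 <= q by rewrite /N; lia.
have ek := swap_exc_lt.
have sN : {in s, forall z, z < N}.
  move=> z zs; have := next_cycle cs zs; by case/edge_lt.
have [ks|ks] := boolP (k \in s).
  have [n s1 rs1] := rot_to ks.
  have := cs; rewrite -(rot_cycle n) rs1 /= rcons_path => /andP[ps1 lk].
  have memE z : (z \in k :: s1) = (z \in s) by rewrite -rs1 mem_rot.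
  have qs1 : q = (size s1).+1 by rewrite -sq -(size_rot n s) rs1.
  have [hs|nhs] := boolP (has exc (k :: s1)).
    have := path_height (sN _ ks) ps1 hs; rewrite qs1 /ilab ltnn subnn /height /=.
    by rewrite add1n.
  have := @path_center k (rcons s1 k).
  rewrite rcons_path ps1 lk last_rcons -rcons_cons has_rcons negb_or nhs.
  rewrite all_rcons /= => /(_ isT erefl); rewrite andbT => /(_ _)/and3P[].
    by clear - ek; rewrite /exc; lia.
  move=> _ _ /allP s1k.
  have eqk z : z \in s -> z = k by rewrite -memE inE => /orP[/eqP|/s1k/eqP].
  by case: xy; rewrite (eqk _ xs) (eqk _ ys).
have [/andP[/andP[/eqP i0 k1s] hs]|nret] := boolP ((i == 0) && (k.-1 \in s) && has exc s).
  have [n s1 rs1] := rot_to k1s.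
  have := cs; rewrite -(rot_cycle n) rs1 /= rcons_path => /andP[ps1 _].
  have := path_height (sN _ k1s) ps1; rewrite -rs1 has_rot hs => /(_ isT).
  have -> : q = (size s1).+1 by rewrite -sq -(size_rot n s) rs1.
  have -> : ilab k.-1 = 2 by clear - k3; rewrite /ilab; case: ifP; lia.
  by rewrite /height i0 /=; lia.
suff : ~~ odd (size s) by rewrite sq oddq.
apply: (@cycle_flip (fun z => z < k)).
suff sub : {in s &, subrel (edge N P) [rel z z' | (z' < k) == ~~ (z < k)]}.
  exact: (sub_in_cycle sub (allss s) cs).
move=> z z' zs z's /= ezz'.
have zk : z <> k by move=> zk; rewrite -zk zs in ks.
have [/orP ze|/norP[/eqP ze /eqP z1e]] := boolP (exc z); last first.
  by have [_ ->] := edge_side ezz' ze z1e zk.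
have ze' : z = e \/ z.+1 = e by case: ze => /eqP; [left|right].
rewrite (swap_exc_side ze') /= eqbF_neg; apply/negP => z'k.
have [i0 z'k1] := edge_exc ezz' ze' z'k.
case/negP: nret; rewrite i0 eqxx -z'k1 z's /=; apply/hasP.
by exists z => //; apply/orP.
Qed.

Lemma iter_swap_map t : t <= N -> visit P e t = pos k (swap b i t).
Proof.
elim: t => [|t IHt] tN; first exact: swap_map_exc.
by rewrite visitS IHt ?swap_map_pos /cnext ?tN // ltnW.
Qed.

(** For [i = 0] the midpoint is visited at time 2, so the walk from the centre to [e] starts two
    steps late; otherwise the exchange of [i] and [i.+2] saves two steps on the way. *)
Lemma swap_has_loop : has_loop (edge N P) (N - 1).
Proof.
have Pe : P e <= k by rewrite swap_map_exc leqNgt pos_odd ?swap_leq // odd_swap.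
have Pr j : k < j <= N -> P j <= k.
  by move=> jk; rewrite leqNgt swap_map_side; have := swap_exc_lt; lia.
have Pl j : j <= k -> j <> e -> k < P j <= N.
  by move=> jk je; rewrite swap_map_leq ?swap_map_side //; rewrite /N; lia.
have vinj t u : t <= N -> u <= N -> visit P e t = visit P e u -> t = u.
  move=> tN uN; rewrite !iter_swap_map // => /(congr1 (lab k)).
  by rewrite !posK ?swap_leq // => /(congr1 (swap b i)); rewrite !swapK.
have vlast : visit P e N = e by rewrite iter_swap_map.
have rvisit := reach_visit swap_exc_lt Pe Pr Pl vinj vlast k3.
have rlab := reach_lab swap_exc_lt Pe Pr Pl vinj vlast k3.
have r0k : reach k P 0 k := reach0k swap_exc_lt Pe.
suff : reach k P (N - 2) e.
  have -> : N - 1 = (N - 2).+1 by rewrite /N; lia.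
  by apply: reach_loop => //; exact: swap_exc_lt.
have k_pos : k = pos k 0 by rewrite /pos /= subn0.
have [i0|i_gt0] := posnP i.
  have v2 : visit P e 2 = k.
    rewrite iter_swap_map; last by rewrite /N; lia.
    by rewrite [RHS]k_pos /swap i0 /= andbF.
  rewrite -vlast -[N - 2]add0n; apply: rvisit.
    by rewrite /N; lia.
  by rewrite v2; exact: r0k.
have v0 : visit P e 0 = k.
  have s0 : swap b i 0 = 0 by rewrite /swap /= !andbF orbF ltn_eqF.
  by rewrite iter_swap_map // s0 -k_pos.
have swapi : swap b i i = i.+2 by rewrite /swap eqxx.
have swapi2 : swap b i i.+2 = i by rewrite -swapi swapK.
have rt : reach k P i (visit P e i).
  rewrite -[i in reach _ _ i]subn0 -[i - 0]add0n.
  apply: rvisit; first by rewrite /N; lia.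
  by rewrite v0; exact: r0k.
have i2N : i.+2 <= N by rewrite /N; lia.
have iN : i <= N by lia.
(* [visit i.+2] lies on the side of [visit i] and nearer to the midpoint, hence is reached equally
   early. *)
have {}rt : reach k P i (visit P e i.+2).
  apply: rlab rt => //=; first by rewrite negbK.
  by rewrite !iter_swap_map // !posK ?swap_leq // swapi swapi2; lia.
have := rvisit i i.+2 N; rewrite vlast (_ : i + (N - i.+2) = N - 2); last by lia.
by apply; rewrite ?i2N ?leqnn.
Qed.
End SwapMap.

(** * Intervals on which the swapped maps increase *)

Lemma swap_succ_lt (b : bool) i m :
  (swap b i (swap b i m.+2).+1 < swap b i (swap b i m).+1) =
  (if b then m == i.+1 else (m.+1 == i) || (m == i)).
Proof.
rewrite /swap; case: b => /=.
all: repeat case: ifP; lia.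
Qed.

Lemma ltn_pos_odd k x y : odd x -> odd y -> (pos k x < pos k y) = (x < y).
Proof. by move=> ox oy; rewrite /pos ox oy; lia. Qed.

Lemma ltn_pos_even k x y : x <= 2 * k -> y <= 2 * k -> ~~ odd x -> ~~ odd y ->
  (pos k x < pos k y) = (y < x).
Proof. by move=> xk yk ox oy; rewrite /pos (negbTE ox) (negbTE oy); lia. Qed.

Section Ascents.
Variables (k : nat) (b : bool) (i : nat).
Hypothesis k3 : 3 <= k.
Hypothesis ib : i.+2 + b <= 2 * k.
Let N := 2 * k.
Notation P := (swap_map k b i).
Notation e := (swap_exc k b i).

Lemma swap_map_lab x : x <= N -> x <> e ->
  P x = pos k (swap b i (swap b i (lab k x)).+1).
Proof. by move=> xN xe; rewrite /swap_map /cnext (swap_lab_neq k3 ib). Qed.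

(** Neighbours on one side have labels differing by 2, and the map decreases between them unless
    their next labels are out of order, which [swap_succ_lt] locates. The centre, where [ilab] is 1,
    is a descent. *)
Lemma swap_map_up j : j < N -> j <> e -> j.+1 <> e ->
  (P j < P j.+1) = (1 < ilab k j) &&
    (if b then ilab k j == i.+3 else (ilab k j == i.+1) || (ilab k j == i.+2)).
Proof.
move=> jN je je1.
have sl := swap_leq k3 ib.
have lt := swap_lab_neq k3 ib (ltnW jN) je; have lt1 := swap_lab_neq k3 ib jN je1.
have [jk|kj|jk] := ltngtP j k.
- have lab2 : lab k j = (lab k j.+1).+2 by clear - jk; rewrite /lab; repeat case: ifP; lia.
  have -> : ilab k j = (lab k j.+1).+2 by rewrite -lab2 /lab /ilab jk ltnW.
  rewrite !swap_map_lab ?(ltnW jN) // ltn_pos_odd.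
  + by rewrite lab2 swap_succ_lt.
  + by rewrite odd_swap /= odd_swap odd_lab -leqNgt ltnW.
  + by rewrite odd_swap /= odd_swap odd_lab -leqNgt.
- have lab2 : lab k j.+1 = (lab k j).+2 by clear - kj; rewrite /lab; repeat case: ifP; lia.
  have -> : ilab k j = (lab k j).+2.
    by rewrite -lab2; clear - kj; rewrite /lab /ilab; repeat case: ifP; lia.
  rewrite !swap_map_lab ?(ltnW jN) // ltn_pos_even.
  + by rewrite lab2 swap_succ_lt.
  + by rewrite sl.
  + by rewrite sl.
  + by rewrite odd_swap /= odd_swap odd_lab kj.
  + by rewrite odd_swap /= odd_swap odd_lab ltnW.
- have -> : ilab k j = 1 by rewrite jk /ilab ltnn subnn.
  have := swap_map_side k3 ib (ltnW jN) je; have := swap_map_side k3 ib jN je1.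
  by rewrite jk leqnn ltnn => p1 p; apply/negbTE; lia.
Qed.
End Ascents.

(** * Turning points *)

(* up j says that a sequence increases from index j to index j.+1. *)
Definition turn_kind (up : pred nat) (j : nat) : option extremum_kind :=
  if up j.-1 then if up j then None else Some Max
  else if up j then Some Min else None.

Definition turns (n : nat) (up : pred nat) : seq extremum_kind :=
  pmap (turn_kind up) (iota 1 n.-1).

(** A list of turns is complete once the direction is constant elsewhere; this allows a symbolic
    [n]. *)
Lemma turnsE n up (zs : seq (nat * extremum_kind)) :
  sorted ltn [seq z.1 | z <- zs] ->
  (forall z, z \in zs -> 0 < z.1 < n /\ turn_kind up z.1 = Some z.2) ->
  (forall j, 0 < j < n -> j \notin [seq z.1 | z <- zs] -> up j = up j.-1) ->
  turns n up = [seq z.2 | z <- zs].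
Proof.
move=> szs zsP nzs; rewrite /turns.
pose F j := isSome (turn_kind up j).
have fE : [seq j <- iota 1 n.-1 | F j] = [seq z.1 | z <- zs].
  apply: (irr_sorted_eq ltn_trans ltnn) => //.
    exact/(sorted_filter ltn_trans)/iota_ltn_sorted.
  move=> j; rewrite mem_filter mem_iota /F; apply/idP/idP => [/andP[tj jn]|].
    apply: contraLR tj => /nzs; rewrite /turn_kind => ->; last by lia.
    by case: (up _).
  case/mapP=> z /zsP[zn tz] ->; rewrite tz /=; case: z zn {tz} => y c /=; lia.
have -> : pmap (turn_kind up) (iota 1 n.-1) =
    map (fun j => odflt Max (turn_kind up j)) ([seq j <- iota 1 n.-1 | F j]).
  elim: (iota 1 n.-1) => [//|j s IHs].
  by rewrite /= IHs /F; case E: (turn_kind up j) => [c|] //=; rewrite E.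
rewrite fE -map_comp; apply/eq_in_map => z /zsP[_ tz].
by rewrite /= tz.
Qed.

Section TurnShapes.
Variables (n : nat) (up : pred nat).

Lemma turns_max : 3 < n ->
  (forall j, j < n -> up j = (j == 0) || (j == 1)) ->
  turns n up = [:: Max].
Proof.
move=> n3 upE; apply: (@turnsE _ _ [:: (2, Max)]).
- by rewrite /=; lia.
- move=> z; rewrite !inE; move=> /eqP-> /=;
    (split; [lia|rewrite /turn_kind !upE /=; try lia;
      repeat (case: ifP => ?); (done || (exfalso; lia))]).
- by move=> j jn; rewrite /= !inE !upE; lia.
Qed.

Lemma turns_min_max : 3 < n ->
  (forall j, j < n -> up j = (j == 1)) ->
  turns n up = [:: Min; Max].
Proof.
move=> n3 upE; apply: (@turnsE _ _ [:: (1, Min); (2, Max)]).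
- by rewrite /=; lia.
- move=> z; rewrite !inE; case/orP=> /eqP-> /=;
    (split; [lia|rewrite /turn_kind !upE /=; try lia;
      repeat (case: ifP => ?); (done || (exfalso; lia))]).
- by move=> j jn; rewrite /= !inE !upE; lia.
Qed.

Lemma turns_min_max_min : 4 < n ->
  (forall j, j < n -> up j = (j == 1) || (j == n.-1)) ->
  turns n up = [:: Min; Max; Min].
Proof.
move=> n4 upE; apply: (@turnsE _ _ [:: (1, Min); (2, Max); (n.-1, Min)]).
- by rewrite /=; lia.
- move=> z; rewrite !inE; case/or3P=> /eqP-> /=;
    (split; [lia|rewrite /turn_kind !upE /=; try lia;
      repeat (case: ifP => ?); (done || (exfalso; lia))]).
- by move=> j jn; rewrite /= !inE !upE; lia.
Qed.

Lemma turns_max_min : 3 < n ->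
  (forall j, j < n -> up j = (j == 0) || (j == n.-1)) ->
  turns n up = [:: Max; Min].
Proof.
move=> n3 upE; apply: (@turnsE _ _ [:: (1, Max); (n.-1, Min)]).
- by rewrite /=; lia.
- move=> z; rewrite !inE; case/orP=> /eqP-> /=;
    (split; [lia|rewrite /turn_kind !upE /=; try lia;
      repeat (case: ifP => ?); (done || (exfalso; lia))]).
- by move=> j jn; rewrite /= !inE !upE; lia.
Qed.

Lemma turns_max_min' : 4 < n ->
  (forall j, j < n -> up j = [|| j == 0, j == 1 | j == n.-1]) ->
  turns n up = [:: Max; Min].
Proof.
move=> n4 upE; apply: (@turnsE _ _ [:: (2, Max); (n.-1, Min)]).
- by rewrite /=; lia.
- move=> z; rewrite !inE; case/orP=> /eqP-> /=;
    (split; [lia|rewrite /turn_kind !upE /=; try lia;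
      repeat (case: ifP => ?); (done || (exfalso; lia))]).
- by move=> j jn; rewrite /= !inE !upE; lia.
Qed.

Lemma turns_max_min_max j1 : 2 <= j1 -> j1.+2 <= n ->
  (forall j, j < n -> up j = (j == 0) || (j == j1)) ->
  turns n up = [:: Max; Min; Max].
Proof.
move=> lo hi upE; apply: (@turnsE _ _ [:: (1, Max); (j1, Min); (j1.+1, Max)]).
- by rewrite /=; lia.
- move=> z; rewrite !inE; case/or3P=> /eqP-> /=;
    (split; [lia|rewrite /turn_kind !upE /=; try lia;
      repeat (case: ifP => ?); (done || (exfalso; lia))]).
- by move=> j jn; rewrite /= !inE !upE; lia.
Qed.

Lemma turns_max_min_max' j1 : 3 <= j1 -> j1.+2 <= n ->
  (forall j, j < n -> up j = [|| j == 0, j == 1 | j == j1]) ->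
  turns n up = [:: Max; Min; Max].
Proof.
move=> lo hi upE; apply: (@turnsE _ _ [:: (2, Max); (j1, Min); (j1.+1, Max)]).
- by rewrite /=; lia.
- move=> z; rewrite !inE; case/or3P=> /eqP-> /=;
    (split; [lia|rewrite /turn_kind !upE /=; try lia;
      repeat (case: ifP => ?); (done || (exfalso; lia))]).
- by move=> j jn; rewrite /= !inE !upE; lia.
Qed.

Lemma turns_max_min_max_min_max j1 j2 : 2 <= j1 -> j1.+2 <= j2 -> j2.+2 <= n ->
  (forall j, j < n -> up j = [|| j == 0, j == j1 | j == j2]) ->
  turns n up = [:: Max; Min; Max; Min; Max].
Proof.
move=> lo mid hi upE; apply: (@turnsE _ _ [:: (1, Max); (j1, Min); (j1.+1, Max); (j2, Min); (j2.+1, Max)]).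
- by rewrite /=; lia.
- move=> z; rewrite !inE; case/or4P=> [/eqP->|/eqP->|/eqP->|/orP[]/eqP->] /=;
    (split; [lia|rewrite /turn_kind !upE /=; try lia;
      repeat (case: ifP => ?); (done || (exfalso; lia))]).
- by move=> j jn; rewrite /= !inE !upE; lia.
Qed.

End TurnShapes.

(** One ascent is at [e]; two exchanges add at most one more, a single exchange at most two. The
    special cases are those where an added ascent is at or next to an end, or, for [i = 0], would
    fall on the centre. *)
Definition swap_shape (k : nat) (b : bool) (i : nat) : seq extremum_kind :=
  if b then
    if i + 6 <= 2 * k then [:: Max; Min; Max]
    else if i + 5 == 2 * k then [:: Max]
    else if i + 4 == 2 * k then [:: Max; Min] else [:: Min; Max]
  else
    if (i == 0) || (i + 4 == 2 * k) then [:: Max; Min; Max]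
    else if i + 5 <= 2 * k then [:: Max; Min; Max; Min; Max]
    else if i + 3 == 2 * k then [:: Max; Min] else [:: Min; Max; Min].

Section SwapShape.
Variables (k : nat) (b : bool) (i : nat).
Hypothesis k3 : 3 <= k.
Hypothesis ib : i.+2 + b <= 2 * k.
Notation P := (swap_map k b i).
Notation e := (swap_exc k b i).

(** The boolean is read as 0 or 1: [e] is the leftmost position unless the last label [2 * k] is
    exchanged, and then it is the second. *)
Lemma swap_excE : e = (2 * k <= i.+2 + b).
Proof.
move: ib; rewrite /swap_exc /swap /pos; case: b => /=; repeat case: ifP; lia.
Qed.

(** As [P e <= k] while the neighbours of [e] map to the right, the interval [e] is an ascent and
    the one before it a descent. *)
Lemma swap_map_upE j : j < 2 * k ->
  (P j < P j.+1) = (j == e) || (j.+1 != e) && (1 < ilab k j) &&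
    (if b then ilab k j == i.+3 else (ilab k j == i.+1) || (ilab k j == i.+2)).
Proof.
move=> jN; have ek := swap_exc_lt k3 ib.
have [je|je] := eqVneq j e.
  have Pe : P e <= k.
    by rewrite swap_map_exc // leqNgt pos_odd ?odd_swap // swap_leq.
  have : k < P e.+1 by rewrite swap_map_side //; lia.
  by rewrite je /=; lia.
have [je1|je1] := eqVneq j.+1 e.
  have Pe : P e <= k.
    by rewrite swap_map_exc // leqNgt pos_odd ?odd_swap // swap_leq.
  have : k < P j by rewrite swap_map_side //; lia.
  by rewrite je1 /=; lia.
by rewrite swap_map_up //; apply/eqP.
Qed.
End SwapShape.

Lemma turns_swap_map k (b : bool) i : 3 <= k -> i.+2 + b <= 2 * k ->
  turns (2 * k) (fun j => swap_map k b i j < swap_map k b i j.+1) = swap_shape k b i.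
Proof.
move=> k3 ib.
have upE j (jN : j < 2 * k) := swap_map_upE k3 ib jN.
rewrite /swap_shape; case: b ib upE => ib upE.
- case: ifP => i6.
    have e0 : swap_exc k true i = 0 by rewrite swap_excE //; lia.
    (* The interval with [ilab k j1 = i.+3]; even labels lie left of the centre. *)
    pose j1 := if odd i then k - i.+3./2 else k + i.+3./2.
    apply: (@turns_max_min_max _ _ j1).
    + by rewrite /j1; case: ifP; lia.
    + by rewrite /j1; case: ifP; lia.
    + move=> j jN; rewrite upE // e0 /ilab /j1; clear - k3 jN i6; repeat case: ifP; lia.
  case: ifP => i5.
    have e0 : swap_exc k true i = 0 by rewrite swap_excE //; lia.
    apply: turns_max; first lia.
    by move=> j jN; rewrite upE // e0 /ilab; clear - k3 jN i5; repeat case: ifP; lia.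
  case: ifP => i4.
    have e0 : swap_exc k true i = 0 by rewrite swap_excE //; lia.
    apply: turns_max_min; first lia.
    by move=> j jN; rewrite upE // e0 /ilab; clear - k3 jN i4; repeat case: ifP; lia.
  have e1 : swap_exc k true i = 1 by rewrite swap_excE //; lia.
  apply: turns_min_max; first lia.
  by move=> j jN; rewrite upE // e1 /ilab; clear - k3 jN i4 i5 i6 ib; repeat case: ifP; lia.
- case: ifP => [/orP[i0|i4]|i04].
  + have e0 : swap_exc k false i = 0 by rewrite swap_excE //; lia.
    apply: (@turns_max_min_max _ _ k.-1); [lia|lia|].
    by move=> j jN; rewrite upE // e0 /ilab; clear - k3 jN i0; repeat case: ifP; lia.
  + have e0 : swap_exc k false i = 0 by rewrite swap_excE //; lia.
    apply: (@turns_max_min_max' _ _ (2 * k - 2)); [lia|lia|].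
    by move=> j jN; rewrite upE // e0 /ilab; clear - k3 jN i4; repeat case: ifP; lia.
  case: ifP => i5.
    have e0 : swap_exc k false i = 0 by rewrite swap_excE //; lia.
    (* Of the labels [i.+1] and [i.+2], the even one gives [j1] on the left and the odd one [j2] on
       the right. *)
    pose j1 := if odd i then k - i.+1./2 else k - i.+2./2.
    pose j2 := k + i.+1./2.
    apply: (@turns_max_min_max_min_max _ _ j1 j2).
    * by rewrite /j1; case: ifP; lia.
    * by rewrite /j1 /j2; case: ifP; lia.
    * by rewrite /j2; lia.
    * move=> j jN; rewrite upE // e0 /ilab /j1 /j2; clear - k3 jN i5 i04; repeat case: ifP; lia.
  case: ifP => i3.
    have e0 : swap_exc k false i = 0 by rewrite swap_excE //; lia.
    apply: turns_max_min'; first lia.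
    by move=> j jN; rewrite upE // e0 /ilab; clear - k3 jN i3; repeat case: ifP; lia.
  have e1 : swap_exc k false i = 1 by rewrite swap_excE //; lia.
  apply: turns_min_max_min; first lia.
  by move=> j jN; rewrite upE // e1 /ilab; clear - k3 jN i3 i5 i04 ib; repeat case: ifP; lia.
Qed.

(** * Permutations as maps of naturals *)

(** Out of range [inord] yields index 0, so the values are at most [n] everywhere. *)
Definition perm_nat n (p : 'S_n.+1) (x : nat) : nat := p (inord x).

Lemma perm_nat_leq n (p : 'S_n.+1) x : perm_nat p x <= n.
Proof. by rewrite -ltnS ltn_ord. Qed.

Lemma perm_nat_val n (p : 'S_n.+1) (i : 'I_n.+1) : perm_nat p i = p i.
Proof. by rewrite /perm_nat inord_val. Qed.

Lemma perm_nat_inj n (p : 'S_n.+1) x y : x <= n -> y <= n ->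
  perm_nat p x = perm_nat p y -> x = y.
Proof. by move=> xn yn /val_inj/perm_inj/(congr1 val); rewrite /= !inordK. Qed.

Lemma eq_perm_nat n (p q : 'S_n.+1) :
  (forall x, x <= n -> perm_nat p x = perm_nat q x) -> p = q.
Proof.
move=> pq; apply/permP => i; apply/val_inj.
by have := pq i; rewrite !perm_nat_val; apply; rewrite -ltnS.
Qed.

Lemma iter_perm_nat n (p : 'S_n.+1) t x : x <= n ->
  iter t (perm_nat p) x = iter t p (inord x).
Proof.
move=> xn; elim: t => [|t IHt]; first by rewrite /= inordK.
by rewrite !iterS IHt perm_nat_val.
Qed.

Lemma cyclic_permP n (p : 'S_n.+1) :
  reflect (forall x y, y \in porbit p x) (cyclic_perm p).
Proof.
apply: (iffP idP) => [cp x y|cp].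
  have /cards1P[A pA] := cp.
  have : porbit p x \in porbits p by apply: imset_f.
  have : porbit p y \in porbits p by apply: imset_f.
  by rewrite pA !inE => /eqP pyA /eqP ->; rewrite -pyA porbit_id.
have oT x : porbit p x = [set: 'I_n.+1]%SET by apply/setP => y; rewrite cp inE.
rewrite /cyclic_perm; apply/cards1P; exists [set: 'I_n.+1]%SET; apply/setP => A; rewrite inE.
apply/imsetP/eqP => [[x _ ->]|->]; first exact: oT.
by exists ord0 => //; rewrite -(oT ord0).
Qed.

Section CyclicPerm.
Variables (n : nat) (p : 'S_n.+1).
Hypothesis cp : cyclic_perm p.

Lemma card_porbit_cyclic x : #|porbit p x| = n.+1.
Proof.
rewrite -[RHS]card_ord -cardsT; apply: eq_card => y.
by move/cyclic_permP: cp => ->; rewrite inE.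
Qed.

Lemma iter_perm_period x : iter n.+1 p x = x.
Proof. by have := iter_porbit p x; rewrite card_porbit_cyclic. Qed.

Lemma iter_perm_inj x t u : t <= n -> u <= n -> iter t p x = iter u p x -> t = u.
Proof.
move=> tn un; have := uniq_traject_porbit p x; rewrite card_porbit_cyclic => ut.
rewrite -!(nth_traject p (_ : _ < n.+1)) //; move/eqP.
by rewrite (nth_uniq x _ _ ut) ?size_traject // => /eqP.
Qed.

Lemma iter_perm_onto x y : exists2 t, t <= n & iter t p x = y.
Proof.
have /cyclic_permP/(_ x y) := cp; rewrite porbit_traject card_porbit_cyclic.
by case/trajectP => t tn ->; exists t.
Qed.

Lemma visit_perm_nat e t : e <= n -> visit (perm_nat p) e t = iter t p (p (inord e)).
Proof. by move=> en; rewrite /visit iter_perm_nat // iterSr. Qed.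

Lemma visit_perm_inj e t u : e <= n -> t <= n -> u <= n ->
  visit (perm_nat p) e t = visit (perm_nat p) e u -> t = u.
Proof.
move=> en tn un; rewrite !visit_perm_nat // => /val_inj; exact: iter_perm_inj.
Qed.

Lemma visit_perm_onto e x : e <= n -> x <= n ->
  exists2 t, t <= n & visit (perm_nat p) e t = x.
Proof.
move=> en xn; have [t tn tx] := iter_perm_onto (p (inord e)) (inord x).
by exists t; rewrite // visit_perm_nat // tx inordK.
Qed.

Lemma visit_perm_last e : e <= n -> visit (perm_nat p) e n = e.
Proof. by move=> en; rewrite visit_perm_nat // -iterSr iter_perm_period inordK. Qed.
End CyclicPerm.

(** * The types *)

Lemma cnext_inj k t u : t <= 2 * k -> u <= 2 * k -> cnext k t = cnext k u -> t = u.
Proof. by rewrite /cnext; repeat case: ifP; lia. Qed.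

(** For the [i] in use the map is a bijection of the range, so the pick succeeds and the default
    [1%g] is not taken. *)
Definition swap_perm k (b : bool) i : 'S_(2 * k).+1 :=
  odflt 1%g [pick p : 'S_(2 * k).+1 |
    [forall x : 'I_(2 * k).+1, p x == swap_map k b i x :> nat]].

Section SwapPerm.
Variables (k : nat) (b : bool) (i : nat).
Hypothesis k3 : 3 <= k.
Hypothesis ib : i.+2 + b <= 2 * k.

Lemma swap_map_inj x y : x <= 2 * k -> y <= 2 * k ->
  swap_map k b i x = swap_map k b i y -> x = y.
Proof.
move=> xN yN /(congr1 (lab k)); have sl := swap_leq k3 ib.
rewrite !posK ?sl ?cnext_leq // => /(congr1 (swap b i)); rewrite !swapK.
move/cnext_inj; rewrite !sl ?lab_leq // => /(_ isT isT).
by move/(congr1 (swap b i)); rewrite !swapK => /(congr1 (pos k)); rewrite !labK.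
Qed.

Lemma swap_permE x : x <= 2 * k -> perm_nat (swap_perm k b i) x = swap_map k b i x.
Proof.
move=> xN; rewrite /perm_nat /swap_perm; case: pickP => [p /forallP/(_ (inord x))|none].
  by move=> /eqP ->; rewrite inordK.
pose f (y : 'I_(2 * k).+1) : 'I_(2 * k).+1 := inord (swap_map k b i y).
have fE y : f y = swap_map k b i y :> nat by rewrite inordK // ltnS swap_map_leq // -ltnS.
have f_inj : injective f.
  move=> u v /(congr1 val); rewrite /= !fE => /swap_map_inj uv.
  by apply/val_inj; apply: uv; rewrite -ltnS.
by have /forallP[] := none (perm f_inj) => y; rewrite permE fE.
Qed.
End SwapPerm.

(** * Distinctness and cyclicity of the swapped orbits *)

Lemma swap_uniq n (b b' : bool) i i' : i.+2 + b <= n -> i'.+2 + b' <= n ->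
  (forall t, t <= n -> swap b i t = swap b' i' t) -> b = b' /\ i = i'.
Proof.
move=> ib ib' e.
have [iN i'N] : i.+1 <= n /\ i' <= n by lia.
have ii : i = i'.
  have := e i (ltnW iN); have := e i' i'N; rewrite /swap !eqxx.
  by case: b b' ib ib' {e} => [] [] ib ib' /=; repeat case: ifP; lia.
split=> //; have := e i.+1 iN; rewrite -ii /swap.
by case: b b' ib ib' {e} => [] [] ib ib' //=; repeat case: ifP; lia.
Qed.

Lemma swap_cnext_neq k (b : bool) i : 3 <= k -> i.+2 + b <= 2 * k ->
  ~ (forall t, t <= 2 * k -> swap b i (cnext k t) = cnext k (swap b i t)).
Proof.
move=> k3 ib e; have [iN i1N] : i <= 2 * k /\ i.+1 <= 2 * k by lia.
have := e i iN; have := e i.+1 i1N; rewrite /swap /cnext.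
by case: b ib {e} => /= ib; repeat case: ifP; lia.
Qed.

Section Uniqueness.
Variables (k : nat) (b : bool) (i : nat).
Hypothesis k3 : 3 <= k.
Hypothesis ib : i.+2 + b <= 2 * k.

Lemma visit_swap_map_leq t : t <= 2 * k ->
  visit (swap_map k b i) (swap_exc k b i) t <= 2 * k.
Proof. by move=> tN; rewrite iter_swap_map // pos_leq // swap_leq. Qed.

(** The exceptional point is the only left one that does not cross, so equal maps share it and visit
    the labels in the same order; [i] is then the first moved time. *)
Lemma swap_map_uniq (b' : bool) i' : i'.+2 + b' <= 2 * k ->
  (forall x, x <= 2 * k -> swap_map k b i x = swap_map k b' i' x) -> b = b' /\ i = i'.
Proof.
move=> ib' PE.
have ek := swap_exc_lt k3 ib; have ek' := swap_exc_lt k3 ib'.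
have eN : swap_exc k b i <= 2 * k by lia.
have ee : swap_exc k b i = swap_exc k b' i'.
  apply/eqP/negPn/negP => /eqP ne.
  have := swap_map_side k3 ib' eN ne; rewrite -PE // swap_map_exc //.
  by rewrite pos_odd ?swap_leq // odd_swap (ltnW ek).
have sE t : t <= 2 * k -> swap b i t = swap b' i' t.
  move=> tN; suff : pos k (swap b i t) = pos k (swap b' i' t).
    by move/(congr1 (lab k)); rewrite !posK ?swap_leq.
  rewrite -!iter_swap_map //; elim: t tN => [|t IHt] tN; first by rewrite /visit /= PE // ee.
  by rewrite !visitS -(IHt (ltnW tN)) PE // visit_swap_map_leq // ltnW.
exact: swap_uniq ib ib' sE.
Qed.

(** The swapped map is the Stefan map conjugated by an involution of the labels, which would have to
    commute with the cyclic shift [cnext]. *)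
Lemma swap_map_neq_stefan :
  ~ (forall x, x <= 2 * k -> swap_map k b i x = pos k (cnext k (lab k x))).
Proof.
move=> PE.
have sE t : t <= 2 * k -> swap b i (cnext k t) = cnext k (swap b i t).
  move=> tN; have := PE (pos k (swap b i t)); rewrite swap_map_pos // posK ?swap_leq //.
  by move=> /(_ (pos_leq (swap_leq k3 ib tN)))/(congr1 (lab k)); rewrite !posK ?swap_leq ?cnext_leq.
exact: swap_cnext_neq sE.
Qed.

Lemma swap_perm_cyclic : cyclic_perm (swap_perm k b i).
Proof.
have ek := swap_exc_lt k3 ib; have eN : swap_exc k b i <= 2 * k by lia.
pose e0 : 'I_(2 * k).+1 := inord (swap_exc k b i).
suff e0P x : x \in porbit (swap_perm k b i) e0.
  by apply/cyclic_permP => x y; move: (e0P x) (e0P y); rewrite -!eq_porbit_mem => /eqP-> /eqP->.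
have xN : x <= 2 * k by rewrite -ltnS.
have -> : x = iter (swap b i (lab k x)).+1 (swap_perm k b i) e0.
  apply/val_inj; rewrite /= -iterS -iter_perm_nat //.
  transitivity (visit (swap_map k b i) (swap_exc k b i) (swap b i (lab k x))).
    by rewrite iter_swap_map ?swap_leq ?lab_leq // swapK labK.
  have : swap b i (lab k x) <= 2 * k by rewrite swap_leq ?lab_leq.
  elim: (swap b i (lab k x)) => [|t IHt] tN.
    by rewrite /visit /= swap_permE.
  by rewrite iterS visitS -(IHt (ltnW tN)) swap_permE // visit_swap_map_leq // ltnW.
by rewrite -permX mem_porbit.
Qed.
End Uniqueness.

Lemma stefan_permE k x : x <= 2 * k ->
  perm_nat (stefan_perm k) x = pos k (cnext k (lab k x)).
Proof.
move=> xN; rewrite /perm_nat permE /= inordK; rewrite inordK //.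
  by rewrite /pos /cnext /lab; repeat case: ifP; lia.
by repeat case: ifP; lia.
Qed.

(* Types a < 2 * k - 1 exchange two labels, the others four. *)
Definition type_double k a : bool := 2 * k - 1 <= a.
Definition type_start k a : nat := if 2 * k - 1 <= a then a - (2 * k - 1) else a.

(** The start [i] has [2 * k - 1] values for a single exchange and [2 * k - 2] for a double one. *)
Definition types k : {set 'S_(2 * k).+1} :=
  [set swap_perm k (type_double k a) (type_start k a) | a : 'I_(4 * k - 3)].

Lemma type_valid k a : 3 <= k -> a < 4 * k - 3 ->
  (type_start k a).+2 + type_double k a <= 2 * k.
Proof. by rewrite /type_start /type_double; case: (leqP (2 * k - 1) a) => /=; lia. Qed.

Lemma typesP k p : 3 <= k ->
  reflect (exists b i, i.+2 + nat_of_bool b <= 2 * k /\ p = swap_perm k b i)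
          (p \in types k).
Proof.
move=> k3; apply: (iffP imsetP) => [[a _ ->]|[b [i [ib ->]]]].
  by exists (type_double k a), (type_start k a); split=> //; apply: type_valid.
pose a := if b then i + (2 * k - 1) else i.
have aP : a < 4 * k - 3 by rewrite /a; case: b ib {a} => /=; lia.
exists (Ordinal aP) => //=; rewrite /type_double /type_start /a.
case: b ib {aP a} => /= ib; first by rewrite leq_addl addnK.
by have -> : (2 * k - 1 <= i) = false by lia.
Qed.

Lemma swap_perm_type_inj k : 3 <= k ->
  injective (fun a : 'I_(4 * k - 3) => swap_perm k (type_double k a) (type_start k a)).
Proof.
move=> k3 a a' aa'; apply/val_inj => /=.
have [va va'] := (type_valid k3 (ltn_ord a), type_valid k3 (ltn_ord a')).
have [|] := swap_map_uniq k3 va va'.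
  by move=> x xN; rewrite -!swap_permE // aa'.
rewrite /type_double /type_start.
by case: (leqP (2 * k - 1) a); case: (leqP (2 * k - 1) a') => //; lia.
Qed.

Lemma card_types k : 3 <= k -> #|types k| = 4 * k - 3.
Proof. by move=> k3; rewrite card_imset ?card_ord //; apply: swap_perm_type_inj. Qed.

(** Turns counts of permutations into counts of codes, which are decided arithmetically. *)
Lemma card_types_pred k (Q : pred 'S_(2 * k).+1) (q : pred nat) : 3 <= k ->
  (forall a, a < 4 * k - 3 -> Q (swap_perm k (type_double k a) (type_start k a)) = q a) ->
  #|[set p in types k | Q p]| = count q (iota 0 (4 * k - 3)).
Proof.
move=> k3 Qq.
pose g (a : 'I_(4 * k - 3)) := swap_perm k (type_double k a) (type_start k a).
have -> : [set p in types k | Q p] = g @: [set a : 'I_(4 * k - 3) | q a].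
  apply/setP => p; rewrite inE; apply/andP/imsetP => [[/imsetP[a _ ->] Qa]|[a]].
    by exists a; rewrite // inE -Qq.
  by rewrite inE => qa ->; split; [apply: imset_f|rewrite Qq].
rewrite card_imset; last exact: swap_perm_type_inj.
by rewrite cardsE cardE /enum_mem size_filter -enumT -val_enum_ord count_map.
Qed.

Lemma count_iota_range lo hi n : lo <= hi <= n ->
  count (fun a => lo <= a < hi) (iota 0 n) = hi - lo.
Proof.
case/andP=> lohi hin.
have -> : iota 0 n = iota 0 lo ++ iota lo (hi - lo) ++ iota hi (n - hi).
  by rewrite -{1}(subnKC hin) -{1}(subnKC lohi) !iotaD !add0n subnKC // catA.
rewrite !count_cat (@eq_in_count _ _ pred0) => [|x]; last by rewrite mem_iota /=; lia.
rewrite count_pred0 (@eq_in_count _ _ predT) => [|x]; last by rewrite mem_iota /=; lia.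
rewrite count_predT size_iota (@eq_in_count _ _ pred0) => [|x].
  by rewrite count_pred0 addn0.
by rewrite mem_iota /=; lia.
Qed.

Lemma stefan_types k : 3 <= k -> stefan_perm k \notin types k.
Proof.
move=> k3; apply/typesP => // -[b [i [ib ss]]].
apply: (swap_map_neq_stefan k3 ib) => x xN.
by rewrite -swap_permE // -ss stefan_permE.
Qed.

Definition simple_map k (P : nat -> nat) e : Prop :=
  [/\ e < k, P e <= k, forall j, k < j <= 2 * k -> P j <= k &
      forall j, j <= k -> j <> e -> k < P j <= 2 * k].

Lemma types_simple k p : 3 <= k -> p \in types k ->
  exists e, simple_map k (perm_nat p) e.
Proof.
move=> k3 /(typesP _ k3)[b [i [ib ->]]]; exists (swap_exc k b i).
have ek := swap_exc_lt k3 ib; split=> // [|j jk|j jk je].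
- have eN : swap_exc k b i <= 2 * k by lia.
  by rewrite swap_permE // swap_map_exc // leqNgt pos_odd ?swap_leq // odd_swap.
- have [kj jN] := andP jk; have je : j <> swap_exc k b i by lia.
  by rewrite swap_permE // leqNgt swap_map_side // -ltnNge.
- have jN : j <= 2 * k by lia.
  by rewrite perm_nat_leq swap_permE // swap_map_side // jk.
Qed.

(** A cyclic permutation is determined by the order of its visits, since on times it acts as
    [cnext]; [visit_label_swap] lists the possible orders. *)
Lemma simple_classification k (p : 'S_(2 * k).+1) e : 3 <= k -> cyclic_perm p ->
  simple_map k (perm_nat p) e -> ~ has_loop (edge (2 * k) (perm_nat p)) (2 * k - 3) ->
  p = stefan_perm k \/ p \in types k.
Proof.
move=> k3 cp [ek Pe Pr Pl] noloop.
have eN : e <= 2 * k by lia.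
have vlast := visit_perm_last cp eN.
have vonto x : x <= 2 * k -> exists2 t, t <= 2 * k & visit (perm_nat p) e t = x.
  exact: visit_perm_onto.
have vinj t u : t <= 2 * k -> u <= 2 * k ->
    visit (perm_nat p) e t = visit (perm_nat p) e u -> t = u.
  exact: visit_perm_inj.
have nextE t : t <= 2 * k ->
    perm_nat p (visit (perm_nat p) e t) = visit (perm_nat p) e (cnext k t).
  rewrite /cnext leq_eqVlt => /orP[/eqP->|tN]; last by rewrite tN visitS.
  by rewrite ltnn vlast.
have vN t : visit (perm_nat p) e t <= 2 * k by rewrite /visit iterS perm_nat_leq.
have [vid|[b [i [ib vsw]]]] := visit_label_swap ek Pe Pr Pl vinj vonto vlast noloop k3.
- left; apply: eq_perm_nat => x xN; rewrite stefan_permE //.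
  have [t tN tx] := vonto _ xN.
  by rewrite -{1}tx nextE // -[LHS](labK (vN _)) !vid ?cnext_leq // -tx vid.
- right; apply/typesP => //; exists b, i; split=> //.
  apply: eq_perm_nat => x xN; rewrite swap_permE //.
  have [t tN tx] := vonto _ xN.
  by rewrite -{1}tx nextE // -[LHS](labK (vN _)) !vsw ?cnext_leq // /swap_map -tx vsw // swapK.
Qed.

(** The edges out of [j] determine the unordered pair of images of its endpoints. Two consecutive
    pairs share exactly the image of the common endpoint. *)
Lemma digraph_inj n : 1 < n -> injective (@digraph n).
Proof.
move=> n1 p q pq.
have bounds (r : 'S_n.+1) j : j < n ->
    minn (perm_nat r j) (perm_nat r j.+1) < maxn (perm_nat r j) (perm_nat r j.+1) <= n.
  move=> jn; have := @perm_nat_inj n r j j.+1; have := perm_nat_leq r j.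
  by have := perm_nat_leq r j.+1; lia.
have mm j : j < n ->
    minn (perm_nat p j) (perm_nat p j.+1) = minn (perm_nat q j) (perm_nat q j.+1) /\
    maxn (perm_nat p j) (perm_nat p j.+1) = maxn (perm_nat q j) (perm_nat q j.+1).
  move=> jn; have bp := bounds p j jn; have bq := bounds q j jn.
  have memE (r : 'S_n.+1) s (sn : s < n) :
      ((Ordinal jn, Ordinal sn) \in digraph r) =
      (minn (perm_nat r j) (perm_nat r j.+1) <= s < maxn (perm_nat r j) (perm_nat r j.+1)).
    rewrite inE /perm_nat /=.
    have -> : widen_ord (leqnSn n) (Ordinal jn) = inord j by apply/val_inj; rewrite /= inordK //; lia.
    by have -> : lift ord0 (Ordinal jn) = inord j.+1 by apply/val_inj; rewrite /= inordK //; lia.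
  have eqs s : s < n ->
      (minn (perm_nat p j) (perm_nat p j.+1) <= s < maxn (perm_nat p j) (perm_nat p j.+1)) =
      (minn (perm_nat q j) (perm_nat q j.+1) <= s < maxn (perm_nat q j) (perm_nat q j.+1)).
    by move=> sn; rewrite -!(memE _ _ sn) pq.
  move: (minn (perm_nat p j) _) (maxn (perm_nat p j) _) (minn (perm_nat q j) _)
    (maxn (perm_nat q j) _) bp bq eqs => a c a' c' bp bq eqs.
  (* Both ranges are nonempty, so testing membership of their first and last elements shows that
     they coincide. *)
  have [n1' n2' n3' n4'] : [/\ a < n, a' < n, c.-1 < n & c'.-1 < n] by split; lia.
  have := eqs _ n1'; have := eqs _ n2'; have := eqs _ n3'; have := eqs _ n4'.
  by clear - bp bq; lia.
have qinj x y : x <= n -> y <= n -> x <> y -> perm_nat q x <> perm_nat q y.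
  by move=> xn yn xy /perm_nat_inj; move/(_ xn yn).
have eq_lt j : j < n -> perm_nat p j = perm_nat q j.
  move=> jn; have := mm j jn.
  have [j1n|nj1] := ltnP j.+1 n.
    have := mm _ j1n; have := qinj j j.+1; have := qinj j j.+2.
    by lia.
  have j1 : j.-1 < n by lia.
  have := mm _ j1; rewrite prednK; last by lia.
  have := qinj j.-1 j.+1; have := qinj j j.+1; lia.
apply: eq_perm_nat => x xn; have [xn'|nx] := ltnP x n; first exact: eq_lt.
have x1 : x.-1 < n by lia.
have := mm _ x1; have := eq_lt _ x1; rewrite prednK; last by lia.
by lia.
Qed.

(** * Order reversal *)

Lemma inverse_permE n (p : 'S_n.+1) x : x <= n ->
  perm_nat (inverse_perm p) x = n - perm_nat p (n - x).
Proof.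
move=> xn; rewrite /perm_nat /inverse_perm !permM !permE /= subSS.
by congr (n - p _); apply/val_inj; rewrite /= !inordK ?subSS // ltnS leq_subr.
Qed.

Lemma inverse_permK n : involutive (@inverse_perm n.+1).
Proof.
move=> p; apply: eq_perm_nat => x xn; rewrite !inverse_permE ?leq_subr //.
by rewrite subKn // subKn // perm_nat_leq.
Qed.

Lemma inverse_cyclic n (p : 'S_n.+1) : cyclic_perm p -> cyclic_perm (inverse_perm p).
Proof.
move=> cp; apply/cyclic_permP => x y.
have iterE t z : iter t (inverse_perm p) z = omega n.+1 (iter t p (omega n.+1 z)).
  elim: t => [|t IHt]; first by rewrite /= !permE /= rev_ordK.
  rewrite !iterS IHt /inverse_perm !permM.
  by congr (omega _ (p _)); rewrite !permE /= rev_ordK.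
have [t _ tE] := iter_perm_onto cp (omega n.+1 x) (omega n.+1 y).
apply/porbitP; exists t; rewrite permX iterE tE !permE /=.
by rewrite rev_ordK.
Qed.

Lemma edge_inverse n (p : 'S_n.+1) i s : edge n (perm_nat (inverse_perm p)) i s ->
  edge n (perm_nat p) (n - i.+1) (n - s.+1).
Proof.
case/and3P => iN sN; rewrite !inverse_permE; try lia.
have := perm_nat_leq p (n - i); have := perm_nat_leq p (n - i.+1).
rewrite /edge (_ : (n - i.+1).+1 = n - i); last by lia.
by lia.
Qed.

Lemma has_loop_inverse n (p : 'S_n.+1) q :
  has_loop (edge n (perm_nat (inverse_perm p))) q -> has_loop (edge n (perm_nat p)) q.
Proof.
move=> [s [sq cs [x [y [xs ys xy]]]]].
exists [seq n - z.+1 | z <- s]; split; first by rewrite size_map.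
  by have := homo_cycle (f := fun z => n - z.+1) (@edge_inverse n p) _ cs.
exists (n - x.+1), (n - y.+1); split; [exact: map_f|exact: map_f|].
have sn z : z \in s -> z < n by move=> zs; have /edge_lt[] := next_cycle cs zs.
by have := sn _ xs; have := sn _ ys; lia.
Qed.

Lemma eq_turns n up up' : (forall j, j < n -> up j = up' j) -> turns n up = turns n up'.
Proof.
move=> e; rewrite /turns; apply: eq_in_pmap => j; rewrite mem_iota => jn.
by rewrite /turn_kind !e //; lia.
Qed.

(** Combinatorial counterpart of the topological structure, free of [f] and the points. *)
Definition perm_turns n (p : 'S_n.+1) : seq extremum_kind :=
  turns n (fun j => perm_nat p j < perm_nat p j.+1).

Lemma perm_turns_swap k b i : 3 <= k -> i.+2 + nat_of_bool b <= 2 * k ->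
  perm_turns (swap_perm k b i) = swap_shape k b i.
Proof.
move=> k3 ib; rewrite -turns_swap_map //; apply: eq_turns => j jN.
by rewrite !swap_permE // ltnW.
Qed.

Lemma pmap_rev (T U : Type) (f : T -> option U) s : pmap f (rev s) = rev (pmap f s).
Proof.
elim: s => //= x s IHs; rewrite rev_cons -cats1 pmap_cat IHs /=.
by case: (f x) => [y|] /=; rewrite ?rev_cons ?cats1 ?cats0.
Qed.

(** The directions are read from the right, so a rise followed by a fall becomes a fall followed by
    a rise. *)
Lemma turns_rev n up :
  turns n (fun j => up (n - j.+1)) = rev [seq swap_kind c | c <- turns n up].
Proof.
have revE : rev (iota 1 n.-1) = [seq n - j | j <- iota 1 n.-1].
  apply: (@eq_from_nth _ 0); first by rewrite size_rev size_map.
  move=> j; rewrite size_rev size_iota => jn.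
  by rewrite nth_rev ?size_iota // (nth_map 0) ?size_iota // !nth_iota; lia.
have omapE s : [seq swap_kind c | c <- pmap (turn_kind up) s] =
    pmap (fun j => omap swap_kind (turn_kind up j)) s.
  by elim: s => //= j s IHs; case: (turn_kind up j) => [c|] /=; rewrite IHs.
rewrite /turns omapE -pmap_rev revE.
have mapE s : pmap (fun j => omap swap_kind (turn_kind up j)) [seq n - j | j <- s] =
    pmap (fun j => omap swap_kind (turn_kind up (n - j))) s.
  by elim: s => //= j s ->.
rewrite mapE; apply: eq_in_pmap => j; rewrite mem_iota => jn.
rewrite /turn_kind (_ : n - j.-1.+1 = n - j); last by lia.
rewrite (_ : (n - j).-1 = n - j.+1); last by lia.
by case: (up _); case: (up _).
Qed.

Lemma perm_turns_inverse n (p : 'S_n.+1) :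
  perm_turns (inverse_perm p) = rev [seq swap_kind c | c <- perm_turns p].
Proof.
rewrite -turns_rev; apply: eq_turns => j jn; rewrite !inverse_permE ?(ltnW jn) //.
rewrite (_ : (n - j.+1).+1 = n - j); last by lia.
by have := perm_nat_leq p (n - j); have := perm_nat_leq p (n - j.+1); lia.
Qed.

Lemma count_disjoint (T : Type) (Q1 Q2 : pred T) (s : seq T) :
  (forall x, ~~ (Q1 x && Q2 x)) ->
  count (fun x => Q1 x || Q2 x) s = count Q1 s + count Q2 s.
Proof.
move=> Q12; rewrite -(count_predUI Q1 Q2 s).
by rewrite (@eq_count _ (predI Q1 Q2) pred0) ?count_pred0 ?addn0 // => x; apply/negbTE/Q12.
Qed.

(** * Numbers of types of each shape *)

Section ShapeCounts.
Variable k : nat.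
Hypothesis k3 : 3 <= k.

Let shape_count s := #|[set p in types k | perm_turns p == s]|.

Lemma shape_countE s (q : pred nat) :
  (forall a, a < 4 * k - 3 -> (swap_shape k (type_double k a) (type_start k a) == s) = q a) ->
  shape_count s = count q (iota 0 (4 * k - 3)).
Proof.
move=> sq; apply: card_types_pred => // a aN.
by rewrite perm_turns_swap ?type_valid // sq.
Qed.

Lemma shape_count_range s lo hi : lo <= hi <= 4 * k - 3 ->
  (forall a, a < 4 * k - 3 ->
     (swap_shape k (type_double k a) (type_start k a) == s) = (lo <= a < hi)) ->
  shape_count s = hi - lo.
Proof. by move=> lh /shape_countE ->; apply: count_iota_range. Qed.

Ltac shape_tac a :=
  rewrite /swap_shape /type_double /type_start;
  case: (leqP (2 * k - 1) a) => ?; repeat case: ifP => ?;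
  ((transitivity true; [by []|]) || (transitivity false; [by []|])); rewrite /=; lia.

Lemma count_max : shape_count [:: Max] = 1.
Proof.
rewrite (@shape_count_range _ (4 * k - 6) (4 * k - 5)); [lia|lia|move=> a aN; shape_tac a].
Qed.

Lemma count_min_max : shape_count [:: Min; Max] = 1.
Proof.
rewrite (@shape_count_range _ (4 * k - 4) (4 * k - 3)); [lia|lia|move=> a aN; shape_tac a].
Qed.

Lemma count_min_max_min : shape_count [:: Min; Max; Min] = 1.
Proof.
rewrite (@shape_count_range _ (2 * k - 2) (2 * k - 1)); [lia|lia|move=> a aN; shape_tac a].
Qed.

Lemma count_max_min_max_min_max : shape_count [:: Max; Min; Max; Min; Max] = 2 * k - 5.
Proof.
rewrite (@shape_count_range _ (1) (2 * k - 4)); [lia|lia|move=> a aN; shape_tac a].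
Qed.

Lemma count_max_min : shape_count [:: Max; Min] = 2.
Proof.
(* The single exchange with [i = 2 * k - 3] and the double one with [i = 2 * k - 4]. *)
rewrite (@shape_countE _ (fun a => (2 * k - 3 <= a < 2 * k - 2) || (4 * k - 5 <= a < 4 * k - 4))).
  rewrite (@count_disjoint _ (fun a => 2 * k - 3 <= a < 2 * k - 2)
    (fun a => 4 * k - 5 <= a < 4 * k - 4)) //; last by move=> a; lia.
  by rewrite !count_iota_range; lia.
by move=> a aN; shape_tac a.
Qed.

Lemma count_max_min_max : shape_count [:: Max; Min; Max] = 2 * k - 3.
Proof.
(* The single exchanges with [i = 0] and [i = 2 * k - 4], and the double ones with
   [i + 6 <= 2 * k]. *)
rewrite (@shape_countE _ (fun a => [|| 0 <= a < 1, 2 * k - 4 <= a < 2 * k - 3 |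
  2 * k - 1 <= a < 4 * k - 6])).
  rewrite (@count_disjoint _ (fun a => 0 <= a < 1)
    (fun a => (2 * k - 4 <= a < 2 * k - 3) || (2 * k - 1 <= a < 4 * k - 6))) //;
    last by move=> a; lia.
  rewrite (@count_disjoint _ (fun a => 2 * k - 4 <= a < 2 * k - 3)
    (fun a => 2 * k - 1 <= a < 4 * k - 6)) //; last by move=> a; lia.
  by rewrite !count_iota_range; lia.
by move=> a aN; shape_tac a.
Qed.
End ShapeCounts.

(** * Periodic points from closed walks *)

Section Analysis.
Import Order.TTheory GRing.Theory Num.Theory numFieldNormedType.Exports.
Local Open Scope classical_set_scope.
Local Open Scope ring_scope.
Variable R : realType.

(** Retraction of the line onto [[a, c]], used to extend maps continuously. *)
Definition clamp (a c x : R) : R := Num.max a (Num.min c x).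

Lemma clamp_in a c x : a <= c -> a <= clamp a c x <= c.
Proof. by move=> ac; rewrite /clamp le_max lexx ge_max ac ge_min lexx. Qed.

Lemma clamp_id a c x : a <= x <= c -> clamp a c x = x.
Proof. by case/andP=> ax xc; rewrite /clamp (min_r xc) (max_r ax). Qed.

Lemma continuous_clamp a c : continuous (clamp a c).
Proof.
move=> x; apply: (@continuous_max _ _ (cst a) (fun x => Num.min c x)).
  exact: cvg_cst.
apply: (@continuous_min _ _ (cst c) id); first exact: cvg_cst.
exact: cvg_id.
Qed.

Lemma continuous_comp_clamp (f : R -> R) a c : a <= c -> {within `[a, c], continuous f} ->
  continuous (f \o clamp a c : R -> R).
Proof.
move=> ac /subspace_continuousP cf x.
have xin : `[a, c]%classic (clamp a c x) by rewrite /= in_itv /= clamp_in.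
apply: (cvg_comp _ _ _ (cf _ xin)).
move=> P nP; have nP' : nbhs (clamp a c x) (fun y => `[a, c]%classic y -> P y) := nP.
have := @continuous_clamp a c x _ nP'.
rewrite !nbhs_simpl /=; apply: filterS => y; apply.
by rewrite /= in_itv /= clamp_in.
Qed.

Lemma continuous_iter (g : R -> R) m : continuous g -> continuous (iter m g).
Proof.
move=> cg; elim: m => [|m IHm] x; first exact: cvg_id.
by apply: (@continuous_comp _ _ _ (iter m g) g); [apply: IHm|apply: cg].
Qed.

Lemma compact_level (g : R -> R) u v c : continuous g ->
  compact (`[u, v] `&` g @^-1` [set c]).
Proof.
move=> cg; apply: (@subclosed_compact _ _ `[u, v]%classic); last by move=> x [].
  apply: closedI; first exact: itv_closed.
  by apply: preimage_closed => [x _|]; [exact: cg|exact: closed_eq].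
exact: segment_compact.
Qed.

Lemma last_level (g : R -> R) u v c a0 : continuous g -> u <= a0 <= v -> g a0 = c ->
  exists a, [/\ u <= a <= v, g a = c & forall x, u <= x <= v -> g x = c -> x <= a].
Proof.
move=> cg a0uv ga0; pose A := `[u, v] `&` g @^-1` [set c].
have [||a] := @compact_EVT_max R R id A _ (compact_level cg).
- by exists a0; split; rewrite /= ?in_itv.
- by apply: continuous_subspaceT => x; exact: cvg_id.
rewrite inE => -[/=]; rewrite in_itv /= => auv ga amax; exists a; split=> // x xuv gx.
by apply: amax; rewrite inE; split; rewrite /= ?in_itv.
Qed.

Lemma first_level (g : R -> R) u v c a0 : continuous g -> u <= a0 <= v -> g a0 = c ->
  exists a, [/\ u <= a <= v, g a = c & forall x, u <= x <= v -> g x = c -> a <= x].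
Proof.
move=> cg a0uv ga0; pose A := `[u, v] `&` g @^-1` [set c].
have [||a] := @compact_EVT_min R R id A _ (compact_level cg).
- by exists a0; split; rewrite /= ?in_itv.
- by apply: continuous_subspaceT => x; exact: cvg_id.
rewrite inE => -[/=]; rewrite in_itv /= => auv ga amax; exists a; split=> // x xuv gx.
by apply: amax; rewrite inE; split; rewrite /= ?in_itv.
Qed.

Lemma ivt (g : R -> R) u v c : continuous g -> u <= v ->
  g u <= c <= g v \/ g v <= c <= g u -> exists2 x, u <= x <= v & g x = c.
Proof.
move=> cg uv gc.
have [||x] := @IVT _ g u v c uv; last by rewrite in_itv; exists x.
  exact: continuous_subspaceT.
rewrite ge_min le_max.
by case: gc => /andP[-> ->]; rewrite ?orbT.
Qed.

(* Between the last visit to c and the next visit to d, g stays in [c, d]. *)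
Lemma crossing_up (g : R -> R) u v c d : continuous g -> u <= v -> c < d ->
  g u <= c -> d <= g v ->
  exists a b, [/\ u <= a, a < b, b <= v, g a = c & g b = d /\
    forall x, a <= x <= b -> c <= g x <= d].
Proof.
move=> cg uv cd guc dgv.
have [|a0 a0uv ga0] := @ivt g u v c cg uv.
  by left; rewrite guc (le_trans (ltW cd) dgv).
have [a [/andP[ua av] ga alast]] := last_level cg a0uv ga0.
have [|b0 b0av gb0] := @ivt g a v d cg av.
  by left; rewrite ga (ltW cd) dgv.
have [b [/andP[ab bv] gb bfirst]] := first_level cg b0av gb0.
have ltab : a < b.
  by rewrite lt_neqAle ab andbT; apply/eqP => e; move: cd; rewrite -ga -gb e ltxx.
exists a, b; split=> //; split=> // x /andP[ax xb]; rewrite !leNgt.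
apply/andP; split; apply/negP => gx.
- have [|y /andP[xy yb] gy] := @ivt g x b c cg xb.
    by left; rewrite (ltW gx) gb (ltW cd).
  have ya : y <= a by apply: alast; rewrite // (le_trans ua (le_trans ax xy)) (le_trans yb bv).
  have xa : x = a by apply/eqP; rewrite eq_le ax (le_trans xy ya).
  by move: gx; rewrite xa ga ltxx.
- have [|y /andP[ay yx] gy] := @ivt g a x d cg ax.
    by left; rewrite ga (ltW cd) (ltW gx).
  have yb : b <= y by apply: bfirst; rewrite // ay (le_trans yx (le_trans xb bv)).
  have xa : x = b by apply/eqP; rewrite eq_le xb (le_trans yb yx).
  by move: gx; rewrite xa gb ltxx.
Qed.

Lemma crossing_down (g : R -> R) u v c d : continuous g -> u <= v -> c < d ->
  d <= g u -> g v <= c ->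
  exists a b, [/\ u <= a, a < b, b <= v, g a = d & g b = c /\
    forall x, a <= x <= b -> c <= g x <= d].
Proof.
move=> cg uv cd dgu gvc.
have cN : continuous (fun x => - g x) by move=> x; apply: cvgN; exact: cg.
have [|||a [b [ua ab bv ga [gb gab]]]] := @crossing_up _ u v (- d) (- c) cN uv.
- by rewrite ltrN2.
- by rewrite lerN2.
- by rewrite lerN2.
exists a, b; split=> //; first by apply/oppr_inj.
split; first by apply/oppr_inj.
by move=> x /gab; rewrite !lerN2 andbC.
Qed.

Section Loops.
Variables (n : nat) (pt : nat -> R) (P : nat -> nat) (g : R -> R).
Hypothesis pt_lt : forall i j, (i < j <= n)%N -> pt i < pt j.
Hypothesis Pn : forall i, (i <= n)%N -> (P i <= n)%N.
Hypothesis gpt : forall i, (i <= n)%N -> g (pt i) = pt (P i).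
Hypothesis cg : continuous g.

Lemma pt_le i j : (i <= j <= n)%N -> pt i <= pt j.
Proof.
case/andP; rewrite leq_eqVlt => /orP[/eqP->//|ij] jn.
by apply/ltW/pt_lt; rewrite ij.
Qed.

(** Built from the end of the walk: the segment found for the tail lies in the interval [y], which
    [x] covers, and is pulled back by a crossing. The final alternative is the orientation. *)
Lemma path_interval x s : (x < n)%N -> path (edge n P) x s -> exists a b,
  [/\ pt x <= a, a < b, b <= pt x.+1,
      forall z, a <= z <= b -> forall j, (j <= size s)%N ->
        pt (nth 0%N (x :: s) j) <= iter j g z <= pt (nth 0%N (x :: s) j).+1 &
      iter (size s) g a = pt (last x s) /\ iter (size s) g b = pt (last x s).+1 \/
      iter (size s) g a = pt (last x s).+1 /\ iter (size s) g b = pt (last x s)].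
Proof.
elim: s x => [|y s IHs] x xn /=.
  move=> _; exists (pt x), (pt x.+1); split=> //; [by apply: pt_lt; rewrite ltnSn| |by left].
  by move=> z zx j; rewrite leqn0 => /eqP->.
case/andP=> exy pys; have [_ yn] := edge_lt exy.
have [a1 [b1 [ya1 ab1 b1y itin1 ends1]]] := IHs y yn pys.
have Px : (P x <= n)%N by apply/Pn/ltnW. have Px1 := Pn xn.
have [a [b [xa ab bx gab gends]]] : exists a b, [/\ pt x <= a, a < b, b <= pt x.+1,
    forall z, a <= z <= b -> a1 <= g z <= b1 &
    g a = a1 /\ g b = b1 \/ g a = b1 /\ g b = a1].
  have xx : pt x <= pt x.+1 by apply: pt_le; rewrite leqnSn.
  have gx : g (pt x) = pt (P x) by apply/gpt/ltnW.
  have gx1 : g (pt x.+1) = pt (P x.+1) by apply/gpt.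
  case/and3P: exy => _ _ /andP[lo hi].
  have [up|down] := leqP (P x) (P x.+1).
    have [||a [b [? ? ? ? [? ?]]]] := @crossing_up g (pt x) (pt x.+1) a1 b1 cg xx ab1.
    - by rewrite gx (le_trans _ ya1) // pt_le; lia.
    - by rewrite gx1 (le_trans b1y) // pt_le; lia.
    by exists a, b; split=> //; left.
  have [||a [b [? ? ? ? [? ?]]]] := @crossing_down g (pt x) (pt x.+1) a1 b1 cg xx ab1.
  - by rewrite gx (le_trans b1y) // pt_le; lia.
  - by rewrite gx1 (le_trans _ ya1) // pt_le; lia.
  by exists a, b; split=> //; right.
exists a, b; split=> //.
- move=> z zab [_|j jn] /=; last by rewrite -iterS iterSr; apply: itin1 => //; exact: gab.
  by case/andP: zab => az zb; rewrite (le_trans xa az) (le_trans zb bx).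
- rewrite -!iterS !iterSr.
  by case: gends => -[-> ->]; case: ends1 => -[-> ->]; [left|right|right|left].
Qed.
Lemma iter_modn q c l : iter q g c = c -> iter l g c = iter (l %% q) g c.
Proof.
move=> gc; rewrite {1}(divn_eq l q) addnC iterD iterM.
by rewrite (iter_fix (l %/ q) (_ : iter q g c = c)).
Qed.

Lemma has_period_dvd q c : (0 < q)%N -> iter q g c = c ->
  exists2 d, has_period g d c & (d %| q)%N.
Proof.
move=> q0 gc.
have exd : exists d, (0 < d)%N && (iter d g c == c) by exists q; rewrite q0 gc eqxx.
have [d /andP[d0 /eqP gd] dmin] := ex_minnP exd; exists d.
  split=> // l /andP[l0 ld] gl; have := dmin l; rewrite l0 gl eqxx => /(_ isT).
  by rewrite leqNgt ld.
rewrite /dvdn -leqn0 leqNgt; apply/negP => r0.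
have := dmin (q %% d)%N; rewrite r0 -iter_modn // gc eqxx => /(_ isT).
by rewrite leqNgt ltn_pmod.
Qed.

(** The segment following the loop is mapped across an interval containing it, so [iter q g] has a
    fixed point there. Its period divides [q]; period 1 would place it in two different intervals,
    hence at a common endpoint, but [P] fixes no index. *)
Lemma loop_orbit q : odd q -> (forall i, (i <= n)%N -> P i <> i) ->
  has_loop (edge n P) q ->
  exists d c, [/\ odd d, (1 < d <= q)%N, has_period g d c &
    forall l, pt 0 <= iter l g c <= pt n].
Proof.
move=> oddq Pfix [[|x0 s] [sq cs [x [y [xs ys xy]]]]] //.
have sn z : z \in x0 :: s -> (z < n)%N.
  by move=> zs; have /edge_lt[] := next_cycle cs zs.
have x0n : (x0 < n)%N by apply: sn; rewrite mem_head.
have [a [b [xa ab bx itin ends]]] := path_interval x0n cs.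
rewrite size_rcons last_rcons -/(size (x0 :: s)) sq in itin ends.
have q0 : (0 < q)%N by rewrite -sq.
have [c cab hc] : exists2 c, a <= c <= b & iter q g c - c = 0.
  apply: ivt; [|exact: ltW|].
    move=> z; apply: cvgB; last exact: cvg_id.
    exact: continuous_iter.
  by case: ends => -[-> ->]; [left|right]; apply/andP; split; lra.
have {}hc : iter q g c = c by apply/eqP; rewrite -subr_eq0 hc.
have itinc z : z \in x0 :: s -> exists2 j, (j < q)%N & pt z <= iter j g c <= pt z.+1.
  move=> zs; have jq : (index z (x0 :: s) < q)%N by rewrite -sq index_mem.
  exists (index z (x0 :: s)) => //; have := itin c cab _ (ltnW jq).
  by rewrite -rcons_cons nth_rcons sq jq nth_index.
have itinq j : (j < q)%N -> exists2 z, (z < n)%N & pt z <= iter j g c <= pt z.+1.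
  move=> jq; exists (nth 0%N (x0 :: s) j); first by apply/sn/mem_nth; rewrite sq.
  by have := itin c cab _ (ltnW jq); rewrite -rcons_cons nth_rcons sq jq.
have [d dc dq] := has_period_dvd q0 hc.
have [d0 gd _] := dc.
exists d, c; split=> //.
- exact: dvdn_odd dq oddq.
- apply/andP; split; last exact: dvdn_leq.
  rewrite ltn_neqAle d0 andbT; apply/eqP => d1.
  have gcc j : iter j g c = c by apply: iter_fix; rewrite -[RHS]gd -d1.
  have cJ z : z \in x0 :: s -> pt z <= c <= pt z.+1.
    by case/itinc => j _; rewrite gcc.
  wlog ltxy : x y xs ys xy / (x < y)%N.
    by move=> wl; have [|xy'|] := ltngtP x y; [exact: wl|apply: (wl y x) => // /esym|].
  have cy : c = pt y.
    apply/eqP; rewrite eq_le; have /andP[-> _] := cJ _ ys; rewrite andbT.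
    have /andP[_ cx1] := cJ _ xs; apply: le_trans cx1 _.
    by apply: pt_le; rewrite ltxy ltnW ?sn.
  have yn := ltnW (sn _ ys).
  have : pt (P y) = pt y by rewrite -gpt // -cy; exact: (gcc 1%N).
  move=> PyE; case: (ltngtP (P y) y) => [lt|lt|]; last exact: Pfix.
    by have := @pt_lt (P y) y; rewrite lt yn PyE ltxx => /(_ isT).
  by have := @pt_lt y (P y); rewrite lt Pn // PyE ltxx => /(_ isT).
- move=> l; rewrite (iter_modn _ hc).
  have [z zn /andP[zl lz]] := itinq _ (ltn_pmod l q0).
  by apply/andP; split; [apply: le_trans zl|apply: le_trans lz _]; apply: pt_le; lia.
Qed.
End Loops.
End Analysis.

(** * The P-linearization *)

Section PLinearization.
Import Order.TTheory GRing.Theory Num.Theory numFieldNormedType.Exports.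
Local Open Scope classical_set_scope.
Local Open Scope ring_scope.
Variables (R : realType) (n : nat) (f : R -> R) (b : 'I_n.+1 -> R) (p : 'S_n.+1).
Hypothesis n0 : (0 < n)%N.
Hypothesis b_incr : increasing_points b.
Hypothesis fbp : has_perm f b p.

Definition point (i : nat) : R := b (inord i).
Local Notation pt := point.
Local Notation P := (perm_nat p).
Local Notation g := (P_linearization f b).

Lemma point_lt i j : (i < j <= n)%N -> pt i < pt j.
Proof. by move=> ij; apply: b_incr; rewrite !inordK; lia. Qed.

Lemma point_perm i : f (pt i) = pt (P i).
Proof. by rewrite /point fbp /perm_nat inord_val. Qed.

Lemma point0 : b ord0 = pt 0.
Proof. by congr b; apply/val_inj; rewrite /= inordK. Qed.

Lemma point_max : b ord_max = pt n.
Proof. by congr b; apply/val_inj; rewrite /= inordK. Qed.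

Lemma widen_inord (i : 'I_n) : widen_ord (leqnSn n) i = inord i.
Proof. by apply/val_inj; rewrite /= inordK // ltnW // ltnS. Qed.

Lemma lift0_inord (i : 'I_n) : lift ord0 i = inord i.+1.
Proof. by apply/val_inj; rewrite /= inordK // ltnS. Qed.

Lemma point_loc x : pt 0 <= x <= pt n -> exists2 i, (i < n)%N & pt i <= x <= pt i.+1.
Proof.
case/andP=> x0 xn.
have exi : exists i, (i <= n)%N && (x <= pt i) by exists n; rewrite leqnn.
have [[|i] /andP[ilen xi] imin] := ex_minnP exi.
  by exists 0%N => //; rewrite x0 (le_trans xi) // ltW // point_lt.
exists i => //; rewrite xi andbT leNgt; apply/negP => xi'.
have := imin i; rewrite (ltW xi') (ltnW ilen) => /(_ isT).
by rewrite ltnn.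
Qed.

Definition slope i : R := (pt (P i.+1) - pt (P i)) / (pt i.+1 - pt i).

(** At a common endpoint the pick may return the neighbouring interval, but the two affine pieces
    agree there. *)
Lemma P_linearizationE i x : (i < n)%N -> pt i <= x <= pt i.+1 ->
  g x = pt (P i) + slope i * (x - pt i).
Proof.
move=> iltn xi.
have segE j : (j < n)%N ->
    line_path (f (pt j)) (f (pt j.+1)) (factor (pt j) (pt j.+1) x) =
    pt (P j) + slope j * (x - pt j).
  move=> jn; have := @point_lt j j.+1; rewrite ltnSn jn => /(_ isT) pj.
  rewrite !point_perm /line_path /factor /slope; field.
  by rewrite subr_eq0 gt_eqF.
rewrite /P_linearization; case: pickP => [j xj|none]; last first.
  have := none (Ordinal iltn).
  by rewrite widen_inord lift0_inord /= -/(point i) -/(point i.+1) xi.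
have jn := ltn_ord j.
move: xj; rewrite widen_inord lift0_inord -/(point j) -/(point j.+1) segE // => xj.
have ptS l : (l < n)%N -> pt l < pt l.+1 by move=> ln; apply: point_lt; rewrite ltnSn.
have slopeS l : (l < n)%N -> pt (P l) + slope l * (pt l.+1 - pt l) = pt (P l.+1).
  move=> ln; rewrite /slope divfK ?subrKC // subr_eq0 gt_eqF //; exact: ptS.
case: (ltngtP i j) => [ij|ji|-> //].
- have ij1 : j = i.+1 :> nat.
    apply/eqP; rewrite eqn_leq ij andbT leqNgt; apply/negP => i1j.
    have := @point_lt i.+1 j; rewrite i1j ltnW // => /(_ isT); lra.
  have -> : x = pt j by apply/eqP; rewrite eq_le; move: xi xj; rewrite ij1; lra.
  by rewrite subrr mulr0 addr0 ij1 slopeS.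
- have ij1 : i = j.+1 :> nat.
    apply/eqP; rewrite eqn_leq ji andbT leqNgt; apply/negP => i1j.
    have := @point_lt j.+1 i; rewrite i1j ltnW // => /(_ isT); lra.
  have -> : x = pt i by apply/eqP; rewrite eq_le; move: xi xj; rewrite ij1; lra.
  by rewrite subrr mulr0 addr0 ij1 slopeS.
Qed.

Lemma P_linearization_point i : (i <= n)%N -> g (pt i) = pt (P i).
Proof.
rewrite leq_eqVlt => /orP[/eqP->|ilen].
  have nn : (n.-1 < n)%N by rewrite prednK.
  have ptn : pt n.-1 < pt n by apply: point_lt; rewrite nn leqnn.
  rewrite (@P_linearizationE n.-1) //; last by rewrite prednK // lexx (ltW ptn).
  by rewrite /slope prednK // divfK ?subrKC // subr_eq0 gt_eqF.
rewrite (@P_linearizationE i) // ?subrr ?mulr0 ?addr0 // lexx.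
by rewrite ltW // point_lt // ltnSn.
Qed.

Lemma P_linearization_continuous : {within `[pt 0, pt n], continuous g}.
Proof.
suff H i : (i <= n)%N -> {within `[pt 0, pt i], continuous g} by exact: H.
elim: i => [_|i IHi iltn].
  by rewrite set_itv1; exact: continuous_subspace1.
have ptS : pt i < pt i.+1 by apply: point_lt; rewrite ltnSn.
have pt0 : pt 0 <= pt i.
  by case: i {IHi ptS} iltn => // i iltn; apply/ltW/point_lt; lia.
have -> : `[pt 0, pt i.+1]%classic = `[pt 0, pt i]%classic `|` `[pt i, pt i.+1]%classic.
  apply/seteqP; split => x /=; rewrite !in_itv /=.
    case/andP=> x0 x1; case: (leP x (pt i)) => xi; [left|right]; first by rewrite x0.
    by rewrite (ltW xi).
  by case=> /andP[h h']; apply/andP; split=> //; [apply: le_trans h' (ltW ptS)|apply: le_trans pt0 h].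
apply: withinU_continuous; [exact: itv_closed|exact: itv_closed|exact/IHi/ltnW|].
pose h x := pt (P i) + slope i * (x - pt i).
apply: (@subspace_eq_continuous _ _ _ h) => [x|].
  by rewrite inE /= in_itv /= => xi; rewrite /from_subspace /h (P_linearizationE iltn).
apply: continuous_subspaceT => x; apply: cvgD; first exact: cvg_cst.
apply: cvgM; first exact: cvg_cst.
by apply: cvgB; [exact: cvg_id|exact: cvg_cst].
Qed.

Lemma hullE : hull b = `[pt 0, pt n]%classic.
Proof. by rewrite /hull point0 point_max. Qed.

Lemma P_linearization_up i x y : (i < n)%N -> (P i < P i.+1)%N ->
  pt i <= x -> x < y -> y <= pt i.+1 -> g x < g y.
Proof.
move=> iltn up ix xy yi; rewrite !(P_linearizationE iltn) ?ix ?yi ?(ltW (lt_le_trans xy yi)) ?(ltW (le_lt_trans ix xy)) //.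
have sl : 0 < slope i.
  apply: divr_gt0; rewrite subr_gt0; last by apply: point_lt; rewrite ltnSn.
  by apply: point_lt; rewrite up perm_nat_leq.
by rewrite ltrD2l ltr_pM2l // ltrD2r.
Qed.

Lemma P_linearization_down i x y : (i < n)%N -> ~~ (P i < P i.+1)%N ->
  pt i <= x -> x < y -> y <= pt i.+1 -> g y < g x.
Proof.
move=> iltn; rewrite -leqNgt leq_eqVlt => /orP[/eqP eP|down] ix xy yi.
  by have := perm_nat_inj iltn (ltnW iltn) eP; lia.
rewrite !(P_linearizationE iltn) ?ix ?yi ?(ltW (lt_le_trans xy yi)) ?(ltW (le_lt_trans ix xy)) //.
have sl : slope i < 0.
  rewrite /slope ltr_pdivrMr ?mul0r ?subr_lt0 ?subr_gt0; last by apply: point_lt; rewrite ltnSn.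
  by apply: point_lt; rewrite down perm_nat_leq.
by rewrite ltrD2l ltr_nM2l // ltrD2r.
Qed.

Lemma P_linearization_between i x : (i < n)%N -> pt i <= x <= pt i.+1 ->
  pt (minn (P i) (P i.+1)) <= g x <= pt (maxn (P i) (P i.+1)).
Proof.
move=> iltn /andP[ix xi].
have gi : g (pt i) = pt (P i) by rewrite P_linearization_point // ltnW.
have gi1 : g (pt i.+1) = pt (P i.+1) by rewrite P_linearization_point.
have ltS : pt i < pt i.+1 by apply: point_lt; rewrite ltnSn.
have [up|down] := boolP (P i < P i.+1)%N.
  have le_g y z : pt i <= y -> y <= z -> z <= pt i.+1 -> g y <= g z.
    move=> iy; rewrite le_eqVlt => /orP[/eqP->//|yz] zi.
    exact: ltW (P_linearization_up iltn up iy yz zi).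
  by rewrite (minn_idPl (ltnW up)) (maxn_idPr (ltnW up)) -gi -gi1 !le_g // ltW.
have le_g y z : pt i <= y -> y <= z -> z <= pt i.+1 -> g z <= g y.
  move=> iy; rewrite le_eqVlt => /orP[/eqP->//|yz] zi.
  exact: ltW (P_linearization_down iltn down iy yz zi).
move: down; rewrite -leqNgt => down.
by rewrite (minn_idPr down) (maxn_idPl down) -gi -gi1 !le_g // ltW.
Qed.

Lemma point_le i j : (i <= j <= n)%N -> pt i <= pt j.
Proof. exact: (pt_le point_lt). Qed.

Lemma P_linearization_interval_map : interval_map (hull b) g.
Proof.
rewrite hullE; split.
- exact: interval_is_interval.
- exists (pt 0), (pt n); split; rewrite /= ?in_itv /= ?lexx ?point_le ?leqnn //.
  by apply: point_lt; rewrite n0 leqnn.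
- exact: P_linearization_continuous.
move=> x /=; rewrite !in_itv /= => /point_loc[i iltn xi].
have /andP[lo hi] := P_linearization_between iltn xi.
have [Pi Pi1] := (perm_nat_leq p i, perm_nat_leq p i.+1).
by apply/andP; split; [apply: le_trans lo|apply: le_trans hi _]; apply: point_le; lia.
Qed.

Lemma iter_P_linearization l j : (j <= n)%N -> iter l g (pt j) = pt (iter l P j).
Proof.
move=> jn; elim: l => [//|l IHl]; rewrite !iterS IHl P_linearization_point //.
by case: l {IHl} => [|l] //; rewrite iterS perm_nat_leq.
Qed.

Lemma point_inj i j : (i <= n)%N -> (j <= n)%N -> pt i = pt j -> i = j.
Proof.
move=> iltn jn e; case: (ltngtP i j) => // h.
  by have := @point_lt i j; rewrite h jn e ltxx => /(_ isT).
by have := @point_lt j i; rewrite h iltn e ltxx => /(_ isT).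
Qed.

(** The points of [b] have period [n.+1 > q], so the given orbit avoids them and each of its points
    lies inside a single interval; these intervals form the walk. It is not constant, because [g] is
    affine on each interval. *)
Lemma orbit_loop q : cyclic_perm p -> odd q -> (1 < q <= n)%N ->
  has_orbit_in g (hull b) q -> has_loop (edge n P) q.
Proof.
move=> cp oddq /andP[q1 qn] [c [[q0 gc cmin]]]; rewrite hullE => chull.
pose x l := iter l g c.
have xq l : iter q g (x l) = x l by rewrite -iterD addnC iterD gc.
have xpt l j : (j <= n)%N -> x l <> pt j.
  move=> jn xj; have := xq l; rewrite xj iter_P_linearization // => /point_inj.
  have itn : (iter q P j <= n)%N by rewrite -(prednK q0) iterS perm_nat_leq.
  move=> /(_ itn jn); rewrite iter_perm_nat // => e.
  have : iter q p (inord j) = iter 0 p (inord j) by apply/val_inj; rewrite /= e inordK.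
  by move/(iter_perm_inj cp qn (leq0n n)); lia.
have loc l : exists i, (i < n)%N /\ pt i < x l < pt i.+1.
  have /= := chull l; rewrite in_itv /= => /point_loc[i iltn /andP[xi xi1]]; exists i.
  split=> //; rewrite !lt_neqAle xi xi1 !andbT; apply/andP; split; apply/eqP => e.
    exact: (@xpt l i (ltnW iltn) (esym e)).
  exact: (@xpt l i.+1 iltn e).
have [w wP] := choice loc.
have wN l : (w l < n)%N by case: (wP l).
have wx l : pt (w l) < x l < pt (w l).+1 by case: (wP l).
have w_uniq i j y : (i < n)%N -> (j < n)%N -> pt i < y < pt i.+1 -> pt j < y < pt j.+1 -> i = j.
  move=> iltn jn /andP[iy yi] /andP[jy yj]; case: (ltngtP i j) => // h.
    have ij : pt i.+1 <= pt j by apply: point_le; rewrite h ltnW.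
    by have := lt_trans (lt_le_trans yi ij) jy; rewrite ltxx.
  have ji : pt j.+1 <= pt i by apply: point_le; rewrite h ltnW.
  by have := lt_trans (lt_le_trans yj ji) iy; rewrite ltxx.
have wq : w q = w 0%N.
  by apply: (@w_uniq _ _ (x q)) => //; rewrite {1 2}/x gc -[c]/(x 0%N).
have wedge l : edge n P (w l) (w l.+1).
  rewrite /edge !wN /=.
  have /andP[wl1 wl2] := wx l; have /andP[wS1 wS2] := wx l.+1.
  have := P_linearization_between (wN l); move/(_ (x l)); rewrite (ltW wl1) (ltW wl2).
  move=> /(_ isT); rewrite -[g (x l)]/(x l.+1) => /andP[lo hi].
  have [Pw Pw1] := (perm_nat_leq p (w l), perm_nat_leq p (w l).+1).
  apply/andP; split; rewrite leqNgt; apply/negP => h.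
    have le : pt (w l.+1).+1 <= pt (minn (P (w l)) (P (w l).+1)) by apply: point_le; lia.
    by have := lt_le_trans wS2 (le_trans le lo); rewrite ltxx.
  have le : pt (maxn (P (w l)) (P (w l).+1)) <= pt (w l.+1).
    by apply: point_le; have := wN l.+1; lia.
  by have := lt_le_trans wS1 (le_trans hi le); rewrite ltxx.
have [q' qE] : exists q', q = q'.+1 by exists q.-1; rewrite prednK.
exists (mkseq w q); split; first by rewrite size_mkseq.
  have -> : mkseq w q = w 0%N :: mkseq (fun l => w l.+1) q'.
    by rewrite qE /mkseq /= (iotaDl 1 0) -map_comp.
  rewrite /=; have -> : rcons (mkseq (fun l => w l.+1) q') (w 0%N) = mkseq (fun l => w l.+1) q.
    by rewrite qE /mkseq -addn1 iotaD map_cat /= add0n -cats1 -qE wq.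
  apply/(pathP 0%N) => l; rewrite size_mkseq => lq.
  rewrite nth_mkseq //; case: l lq => [|l] lq //=.
  by rewrite nth_mkseq // ltnW.
have [/existsP[l /eqP wl]|const] := boolP [exists l : 'I_q, w l != w 0%N].
  exists (w l), (w 0%N); split=> //; apply: map_f; rewrite mem_iota add0n //=.
exfalso; pose i := w 0%N; pose al := slope i.
have xJ l : pt i <= x l <= pt i.+1.
  have -> : x l = x (l %% q)%N by exact: iter_modn.
  have lq := ltn_pmod l q0.
  have : w (l %% q)%N = i.
    by apply/eqP/negPn; apply: contra const => h; apply/existsP; exists (Ordinal lq).
  by have /andP[h h'] := wx (l %% q)%N; move=> <-; rewrite !ltW.
have xS l : x l.+1 = pt (P i) + al * (x l - pt i) by rewrite -P_linearizationE // wN.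
(* Over two steps [d] is multiplied by a square, so its values at even times do not change sign;
   summed over two rounds of the orbit they telescope to 0. *)
pose d l := x l.+2 - x l.
have dS l : d l.+1 = al * d l by rewrite /d (xS l.+2) (xS l); ring.
have dE l : d (2 * l)%N = (al ^+ 2) ^+ l * d 0%N.
  elim: l => [|l IHl]; first by rewrite expr0 mul1r.
  by rewrite mulnS add2n !dS IHl (exprS _ l); move: (_ ^+ l) (d 0%N) => A D; ring.
have sum0 : \sum_(0 <= l < q) d (2 * l)%N = 0.
  rewrite (eq_bigr (fun l => x (2 * l.+1)%N - x (2 * l)%N)); last by move=> l _; rewrite mulnS add2n.
  rewrite (telescope_sumr (fun l => x (2 * l)%N)) // muln0.
  by rewrite -[x 0%N]/c /x iterM (iter_fix 2 gc) subrr.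
have d0 : d 0%N = 0.
  move: sum0; rewrite (eq_bigr (fun l => (al ^+ 2) ^+ l * d 0%N)) => [|l _]; last exact: dE.
  rewrite -mulr_suml => /eqP; rewrite mulf_eq0 => /orP[|/eqP//].
  (* The first summand is 1 and the others are powers of a square. *)
  rewrite gt_eqF // big_ltn // expr0 ltr_pwDl //.
  by apply: sumr_ge0 => l _; rewrite exprn_ge0 // sqr_ge0.
have := cmin 2%N; have q2 : (2 < q)%N by case: q q1 oddq {q0 qn cmin gc qE wq xq const sum0} => [|[|[|]]].
rewrite q2 => /(_ isT); apply; apply/eqP; rewrite -subr_eq0; exact/eqP.
Qed.
End PLinearization.

(** * Local extrema of the P-linearization *)

Section Extrema.
Import Order.TTheory GRing.Theory Num.Theory numFieldNormedType.Exports.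
Local Open Scope classical_set_scope.
Local Open Scope ring_scope.
Variable R : realType.

Lemma near_between (x a c : R) : a < x < c -> \forall y \near x, a < y < c.
Proof.
move=> xac; have := @near_in_itvoo R a c x; rewrite in_itv /= => /(_ xac).
by apply: filterS => y; rewrite in_itv.
Qed.

Lemma near_right (x c : R) (Q : R -> Prop) : x < c -> (\forall y \near x, Q y) ->
  exists y, x < y < c /\ Q y.
Proof.
move=> xc /nbhs_ballP[e /= e0 eQ].
have m0 : 0 < Num.min e (c - x) by rewrite lt_min e0 subr_gt0.
have me : Num.min e (c - x) <= e by rewrite ge_min lexx.
have mc : Num.min e (c - x) <= c - x by rewrite ge_min lexx orbT.
exists (x + Num.min e (c - x) / 2); split; first by lra.
apply: eQ; rewrite /ball /= opprD addrA subrr add0r normrN gtr0_norm; lra.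
Qed.

Lemma near_left (x a : R) (Q : R -> Prop) : a < x -> (\forall y \near x, Q y) ->
  exists y, a < y < x /\ Q y.
Proof.
move=> xc /nbhs_ballP[e /= e0 eQ].
have m0 : 0 < Num.min e (x - a) by rewrite lt_min e0 subr_gt0.
have me : Num.min e (x - a) <= e by rewrite ge_min lexx.
have mc : Num.min e (x - a) <= x - a by rewrite ge_min lexx orbT.
exists (x - Num.min e (x - a) / 2); split; first by lra.
apply: eQ; rewrite /ball /= opprB addrC subrK gtr0_norm; lra.
Qed.

(** Both lists are strictly sorted by position and have the same members. *)
Lemma extrema_arrangement_uniq (g : R -> R) a c s s' :
  extrema_arrangement g a c s -> extrema_arrangement g a c s' -> s = s'.
Proof.
move=> [xs [sxs -> xsE]] [xs' [sxs' -> xsE']]; congr map.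
rewrite !sorted_map in sxs sxs'.
apply: (irr_sorted_eq _ _ sxs sxs') => [y x z|x|z] /=; [exact: lt_trans|exact: ltxx|].
by apply/idP/idP; [move/xsE/xsE'|move/xsE'/xsE].
Qed.

Section PLinExtrema.
Variables (n : nat) (f : R -> R) (b : 'I_n.+1 -> R) (p : 'S_n.+1).
Hypothesis n0 : (0 < n)%N.
Hypothesis b_incr : increasing_points b.
Hypothesis fbp : has_perm f b p.
Local Notation pt := (point b).
Local Notation P := (perm_nat p).
Local Notation g := (P_linearization f b).
Local Notation up := (fun j => (P j < P j.+1)%N).
Let pt_lt := point_lt n0 b_incr.

Lemma not_extremum_inside i x e : (i < n)%N -> pt i < x < pt i.+1 ->
  ~ is_extremum g x e.
Proof.
move=> iltn /andP[ix xi].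
have [upi|downi] := boolP (up i); case: e => /=.
- move=> /(near_right xi)[y [/andP[xy yi]]]; rewrite leNgt => /negP; apply.
  by apply: (P_linearization_up n0 b_incr fbp iltn upi); rewrite ?ltW.
- move=> /(near_left ix)[y [/andP[iy yx]]]; rewrite leNgt => /negP; apply.
  by apply: (P_linearization_up n0 b_incr fbp iltn upi); rewrite ?ltW.
- move=> /(near_left ix)[y [/andP[iy yx]]]; rewrite leNgt => /negP; apply.
  by apply: (P_linearization_down n0 b_incr fbp iltn downi); rewrite ?ltW.
- move=> /(near_right xi)[y [/andP[xy yi]]]; rewrite leNgt => /negP; apply.
  by apply: (P_linearization_down n0 b_incr fbp iltn downi); rewrite ?ltW.
Qed.

Lemma extremum_turn j e : (0 < j < n)%N ->
  is_extremum g (pt j) e <-> turn_kind up j = Some e.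
Proof.
case/andP=> j0 jn; have j1n : (j.-1 < n)%N by lia.
have jS : (j.-1).+1 = j by lia.
have ltl : pt j.-1 < pt j by apply: pt_lt; lia.
have ltr : pt j < pt j.+1 by apply: pt_lt; lia.
have upR y z : up j -> pt j <= y -> y < z -> z <= pt j.+1 -> g y < g z.
  exact: (P_linearization_up n0 b_incr fbp jn).
have downR y z : ~~ up j -> pt j <= y -> y < z -> z <= pt j.+1 -> g z < g y.
  exact: (P_linearization_down n0 b_incr fbp jn).
have upL y z : up j.-1 -> pt j.-1 <= y -> y < z -> z <= pt j -> g y < g z.
  by have := @P_linearization_up _ _ _ _ _ n0 b_incr fbp _ y z j1n; rewrite /= jS.
have downL y z : ~~ up j.-1 -> pt j.-1 <= y -> y < z -> z <= pt j -> g z < g y.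
  by have := @P_linearization_down _ _ _ _ _ n0 b_incr fbp _ y z j1n; rewrite /= jS.
rewrite /turn_kind; split.
- case: e => /= ext.
  + have [y [/andP[jy yj]]] := near_right ltr ext; rewrite leNgt => gy.
    have [z [/andP[jz zj]]] := near_left ltl ext; rewrite leNgt => gz.
    case: ifP => [_|/negbT dl]; last by rewrite downL ?lexx ?ltW in gz.
    by case: ifP => // ur; rewrite upR ?lexx ?ltW in gy.
  + have [y [/andP[jy yj]]] := near_right ltr ext; rewrite leNgt => gy.
    have [z [/andP[jz zj]]] := near_left ltl ext; rewrite leNgt => gz.
    case: ifP => [ul|_]; first by rewrite upL ?lexx ?ltW in gz.
    by case: ifP => // /negbT dr; rewrite downR ?lexx ?ltW in gy.
- have nb : \forall y \near pt j, pt j.-1 < y < pt j.+1 by apply: near_between; rewrite ltl ltr.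
  case: ifP => [ul|/negbT dl]; case: ifP => [ur|/negbT dr] // [<-] /=; apply: filterS nb => y /andP[jy yj].
  + case: (ltgtP y (pt j)) => [lt|gt|->]; rewrite ?lexx //; apply: ltW; [apply: upL|apply: downR] => //; exact: ltW.
  + case: (ltgtP y (pt j)) => [lt|gt|->]; rewrite ?lexx //; apply: ltW; [apply: downL|apply: upR] => //; exact: ltW.
Qed.

Lemma extrema_P_linearization :
  extrema_arrangement g (b ord0) (b ord_max) (perm_turns p).
Proof.
rewrite (point0 b) (point_max b).
pose F j := omap (fun c => (pt j, c)) (turn_kind up j).
exists (pmap F (iota 1 n.-1)); split.
- pose Q j := isSome (turn_kind up j).
  have -> : [seq z.1 | z <- pmap F (iota 1 n.-1)] = [seq pt j | j <- [seq j <- iota 1 n.-1 | Q j]].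
    elim: (iota _ _) => //= j s; rewrite /F /Q.
    by case tj: (turn_kind _ j) => [c|] //= ->.
  rewrite sorted_map; have sub : {in [pred j | (j <= n)%N] &, subrel ltn (relpre pt <%R)}.
    by move=> i j /= _ jn ij; apply: pt_lt; rewrite ij.
  apply: (sub_in_sorted sub); last exact: (sorted_filter ltn_trans) (iota_ltn_sorted _ _).
  by apply/allP => j; rewrite mem_filter mem_iota inE => /andP[_]; lia.
- rewrite /perm_turns /turns; elim: (iota _ _) => //= j s; rewrite /F.
  by case tj: (turn_kind _ j) => [c|] //= ->.
- move=> [x e] /=; split.
    rewrite mem_pmap => /mapP[j]; rewrite mem_iota /F => jn.
    case tj: (turn_kind _ j) => [c|] //= [-> ->].
    have j0n : (0 < j < n)%N by lia.
    split; last exact/extremum_turn.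
    by rewrite !pt_lt //; lia.
  case=> /andP[x0 xn] ext.
  have [|i iltn /andP[ix xi]] := @point_loc _ _ b n0 b_incr x; first by rewrite !ltW.
  have [j /andP[j0 jn] xj] : exists2 j, (0 < j < n)%N & x = pt j.
    move: ix; rewrite le_eqVlt => /orP[/eqP e1|ix].
      exists i => //; rewrite iltn andbT lt0n; apply/eqP => i0.
      by move: x0; rewrite -e1 i0 ltxx.
    move: xi; rewrite le_eqVlt => /orP[/eqP e1|xi].
      exists i.+1 => //=; rewrite ltn_neqAle iltn andbT; apply/eqP => i1.
      by move: xn; rewrite e1 i1 ltxx.
    by case: (@not_extremum_inside i x e); rewrite ?ix.
  have jin : (0 < j < n)%N by rewrite j0.
  rewrite mem_pmap; apply/mapP; exists j; first by rewrite mem_iota; lia.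
  by move: ext; rewrite xj /F => /(extremum_turn _ jin) ->.
Qed.
End PLinExtrema.
End Extrema.

(** * Orbits and their permutations *)

Section Orbits.
Import Order.TTheory GRing.Theory Num.Theory numFieldNormedType.Exports.
Local Open Scope classical_set_scope.
Local Open Scope ring_scope.
Variable R : realType.

(** All realisations have the arrangement [perm_turns p]; one of them, on the points 0, ..., [n],
    serves for the converse. *)
Lemma topological_structureE n (p : 'S_n.+1) s : (0 < n)%N ->
  topological_structure R p s <-> perm_turns p = s.
Proof.
move=> n0; split=> [top|<- f b b_incr fbp]; last exact: extrema_P_linearization.
pose b (i : 'I_n.+1) : R := (i : nat)%:R.
pose f x := if [pick i | b i == x] is Some i then b (p i) else 0.
have b_incr : increasing_points b by move=> i j ij; rewrite /b ltr_nat.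
have fbp : has_perm f b p.
  move=> i; rewrite /f; case: pickP => [j /eqP|/(_ i)]; last by rewrite eqxx.
  by move/eqP; rewrite eqr_nat => /eqP/val_inj ->.
by have := extrema_arrangement_uniq (extrema_P_linearization n0 b_incr fbp) (top _ _ b_incr fbp).
Qed.

Lemma count_structureE n (T : {set 'S_n.+1}) s : (0 < n)%N ->
  count_structure R T s = #|[set p in T | perm_turns p == s]|.
Proof.
move=> n0; apply: eq_card => p; rewrite !inE; congr (_ && _).
by apply/asboolP/eqP => /topological_structureE; apply.
Qed.

Section OrbitPerm.
Variables (n : nat) (f : R -> R) (b : 'I_n.+1 -> R).
Hypothesis n0 : (0 < n)%N.
Hypothesis b_incr : increasing_points b.

Lemma points_inj : injective b.
Proof.
move=> i j e; apply/val_inj; case: (ltngtP i j) => // h.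
  by have := b_incr h; rewrite e ltxx.
by have := b_incr h; rewrite e ltxx.
Qed.

Lemma iter_has_perm p : has_perm f b p -> forall l i, iter l f (b i) = b (iter l p i).
Proof. by move=> fbp l i; elim: l => [//|l IHl]; rewrite !iterS IHl fbp. Qed.

(** Every point of the orbit has a preimage in it; choosing preimages gives an injection, whose
    inverse is the permutation. *)
Lemma orbit_has_perm : is_orbit f b -> exists p, has_perm f b p.
Proof.
move=> [_ [c [_ cper _] rb]].
have pre j : exists i, f (b i) = b j.
  have [l /= ln lj] : [set iter l f c | l in `I_n.+1] (b j) by rewrite -rb; exists j.
  have [l' l'n fl'] : exists2 l', (l' < n.+1)%N & f (iter l' f c) = b j.
    case: l ln lj => [_ /= cj|l ln lj]; last by exists l; rewrite // ltnW.
    by exists n; rewrite // -iterS cper.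
  have [i _ bi] : range b (iter l' f c) by rewrite rb; exists l'.
  by exists i; rewrite bi.
have [h hP] := choice pre.
have h_inj : injective h by move=> i j e; apply: points_inj; rewrite -(hP i) -(hP j) e.
by exists (perm h_inj)^-1%g => i; rewrite -[RHS]hP -(permE h_inj) permKV.
Qed.

Lemma orbit_cyclic p : is_orbit f b -> has_perm f b p -> cyclic_perm p.
Proof.
move=> [_ [c [_ _ _] rb]] fbp.
have [i0 _ bi0] : range b c by rewrite rb; exists 0%N.
have i0P x : x \in porbit p i0.
  have [l _ lx] : [set iter l f c | l in `I_n.+1] (b x) by rewrite -rb; exists x.
  apply/porbitP; exists l; apply: points_inj.
  by rewrite permX -iter_has_perm // bi0 lx.
apply/cyclic_permP => x y.
by move: (i0P x) (i0P y); rewrite -!eq_porbit_mem => /eqP-> /eqP->.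
Qed.

Lemma cyclic_is_orbit p : cyclic_perm p -> has_perm f b p -> is_orbit f b.
Proof.
move=> cp fbp; split=> //; exists (b ord0).
  split=> // [|l /andP[l1 ln]]; first by rewrite (iter_has_perm fbp) iter_perm_period.
  rewrite (iter_has_perm fbp) => /points_inj h.
  have : iter l p ord0 = iter 0 p ord0 by [].
  by move/(iter_perm_inj cp); rewrite -ltnS ln => /(_ isT isT) l0; rewrite l0 in l1.
apply/seteqP; split => x /=.
  case=> j _ <-; have [t tn tj] := iter_perm_onto cp ord0 j.
  by exists t; rewrite //= (iter_has_perm fbp) tj.
by case=> l _ <-; exists (iter l p ord0); rewrite // (iter_has_perm fbp).
Qed.

(* Replacing f by its extension by constants outside the hull makes it
   continuous on the whole line without changing the orbits in the hull. *)
Lemma loop_has_orbit p q : {within hull b, continuous f} -> has_perm f b p ->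
  cyclic_perm p -> odd q -> has_loop (edge n (perm_nat p)) q ->
  exists d, [/\ odd d, (1 < d <= q)%N & has_orbit_in f (hull b) d].
Proof.
rewrite hullE => cf fbp cp oddq loopq.
pose pt := point b; have pt_lt := point_lt n0 b_incr.
have le0 : pt 0 <= pt n by apply: (pt_le pt_lt); rewrite leqnn.
have cg := continuous_comp_clamp le0 cf.
have gE x : pt 0 <= x <= pt n -> (f \o clamp (pt 0) (pt n)) x = f x.
  by move=> xin; rewrite /= clamp_id.
have gpt i : (i <= n)%N -> (f \o clamp (pt 0) (pt n)) (pt i) = pt (perm_nat p i).
  move=> iltn; rewrite gE ?(point_perm fbp) //.
  by apply/andP; split; apply: (pt_le pt_lt); lia.
have fix_free i : (i <= n)%N -> perm_nat p i <> i.
  move=> iltn e; have : iter 1 p (inord i) = iter 0 p (inord i).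
    by apply/val_inj; rewrite /= [RHS]inordK.
  by move/(iter_perm_inj cp n0 (leq0n n)).
have Pn i : (i <= n)%N -> (perm_nat p i <= n)%N by rewrite perm_nat_leq.
have [d [c [oddd dq [d0 gd gmin] orb]]] := loop_orbit pt_lt Pn gpt cg oddq fix_free loopq.
have iterE l : iter l f c = iter l (f \o clamp (pt 0) (pt n)) c.
  by elim: l => [//|l IHl]; rewrite !iterS IHl -(gE _ (orb l)).
exists d; split=> //; exists c; split=> [|l]; last by rewrite /= in_itv /= iterE.
by split; rewrite // ?iterE // => l ld; rewrite iterE; apply: gmin.
Qed.
End OrbitPerm.

(** * Simplicity in terms of indices *)

Section Simple.
Variables (k : nat) (f : R -> R) (b : 'I_(2 * k).+1 -> R) (p : 'S_(2 * k).+1).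
Hypothesis b_incr : increasing_points b.
Hypothesis fbp : has_perm f b p.

Lemma block_point (l : 'I_(2 * k).+1) i j : block b i j (b l) <-> (i <= l.+1 <= j)%N.
Proof. by split=> [[l' /= h /(points_inj b_incr) <-]|h]; last exists l. Qed.

Lemma maps_intoP i j i' j' :
  maps_into f (block b i j) (block b i' j') <->
  (forall l : 'I_(2 * k).+1, (i <= l.+1 <= j)%N -> (i' <= (p l).+1 <= j')%N).
Proof.
split=> [h l lij|h x [l /= lij <-]]; last by rewrite fbp; apply/block_point/h.
by apply/block_point; rewrite -fbp; apply: h; apply/block_point.
Qed.

Lemma maps_all_but_one_intoP i j i' j' :
  maps_all_but_one_into f (block b i j) (block b i' j') <->
  (exists e : 'I_(2 * k).+1, [/\ (i <= e.+1 <= j)%N, ~ (i' <= (p e).+1 <= j')%N &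
     forall l : 'I_(2 * k).+1, (i <= l.+1 <= j)%N -> l <> e -> (i' <= (p l).+1 <= j')%N]).
Proof.
split.
- move=> [x [[e /= eij <-] nC h]]; exists e; split=> //.
    by move=> pe; apply: nC; rewrite fbp; apply/block_point.
  move=> l lij le; apply/block_point; rewrite -fbp; apply: h; first exact/block_point.
  by move/(points_inj b_incr).
- move=> [e [eij npe h]]; exists (b e); split; first exact/block_point.
    by rewrite fbp => /block_point.
  move=> x [l /= lij <-] le; rewrite fbp; apply/block_point/h => //.
  by move=> e'; apply: le; rewrite e'.
Qed.

(** The clause on the midpoint of [simple_pos] corresponds to the strict [e < k]. *)
Lemma simple_posP : simple_pos f b <-> exists e, simple_map k (perm_nat p) e.
Proof.
split.
- move=> [/maps_intoP r /maps_all_but_one_intoP[e [ek pe l]] /maps_intoP m].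
  have valE (x : 'I_(2 * k).+1) : perm_nat p x = p x by rewrite perm_nat_val.
  have ltp (x : 'I_(2 * k).+1) := ltn_ord (p x).
  have kN : (k < (2 * k).+1)%N by lia.
  have nek : e <> Ordinal kN by move=> e'; apply: pe; rewrite e'; apply: m => /=; lia.
  have ek' : (e <> k :> nat) by move=> e'; apply: nek; apply/val_inj.
  have ltpe := ltp e.
  exists e; split; first by lia.
  + by rewrite valE; lia.
  + move=> j /andP[kj jN]; have jN' : (j < (2 * k).+1)%N by lia.
    by have := r (Ordinal jN'); rewrite -(valE (Ordinal jN')) /=; lia.
  + move=> j jk je; have jN' : (j < (2 * k).+1)%N by lia.
    rewrite perm_nat_leq andbT; have := l (Ordinal jN'); rewrite -(valE (Ordinal jN')) /=.
    move=> /(_ ltac:(lia)) h; have : Ordinal jN' <> e by move=> e'; apply: je; rewrite -e'.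
    by move/h; lia.
- move=> [e [ek pe r l]]; split.
  + apply/maps_intoP => j jk; rewrite -perm_nat_val.
    by have := r j; have := ltn_ord j; lia.
  + apply/maps_all_but_one_intoP; have eN : (e < (2 * k).+1)%N by lia.
    exists (Ordinal eN); split=> [||j jk je]; rewrite -?perm_nat_val /=; [lia|lia|].
    have je' : j <> e :> nat by move=> e'; apply: je; apply/val_inj.
    by have := l j; lia.
  + apply/maps_intoP => j jk; rewrite -perm_nat_val.
    have -> : j = k :> nat by lia.
    by have := l k; lia.
Qed.

Lemma simple_neg_inverse : simple_neg f b ->
  exists e, simple_map k (perm_nat (inverse_perm p)) e.
Proof.
move=> [/maps_intoP r /maps_all_but_one_intoP[e [ek pe l]] /maps_intoP m].
have valE (x : 'I_(2 * k).+1) : perm_nat p x = p x by rewrite perm_nat_val.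
have kN : (k < (2 * k).+1)%N by lia.
have ltpe := ltn_ord (p e); have lte := ltn_ord e.
have nek : e <> Ordinal kN by move=> e'; apply: pe; rewrite e'; apply: m => /=; lia.
have ek' : (e <> k :> nat) by move=> e'; apply: nek; apply/val_inj.
exists (2 * k - e)%N; split; first by lia.
- rewrite inverse_permE ?leq_subr // subKn ?valE; lia.
- move=> j /andP[kj jN]; rewrite inverse_permE //.
  have jN' : (2 * k - j < (2 * k).+1)%N by lia.
  by have := r (Ordinal jN'); rewrite -(valE (Ordinal jN')) /=; lia.
- move=> j jk je; rewrite inverse_permE ?leq_subr ?andbT; last by lia.
  have jN' : (2 * k - j < (2 * k).+1)%N by lia.
  have je' : Ordinal jN' <> e by move=> e'; apply: je; rewrite -e' /=; lia.
  have := l (Ordinal jN'); rewrite -(valE (Ordinal jN')) /=.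
  by move=> /(_ ltac:(lia) je'); lia.
Qed.
End Simple.
End Orbits.

(** * Second minimality and closed walks *)

Lemma eq_has_loop N P Q q : (forall x, x <= N -> P x = Q x) ->
  has_loop (edge N P) q -> has_loop (edge N Q) q.
Proof.
move=> PQ [s [sq cs nc]]; exists s; split=> //; apply: sub_cycle cs => i j.
by rewrite /edge => /and3P[iN jN ij]; rewrite iN jN -!PQ // ltnW.
Qed.

(* The closed walks of a permutation that make one of its orbits second minimal. *)
Definition loops_from k (P : nat -> nat) : Prop :=
  (forall q, odd q -> has_loop (edge (2 * k) P) q -> 2 * k - 1 <= q) /\
  has_loop (edge (2 * k) P) (2 * k - 1).

Lemma types_loops k p : 3 <= k -> p \in types k -> loops_from k (perm_nat p).
Proof.
move=> k3 /(typesP _ k3)[b [i [ib ->]]]; split=> [q oddq lq|].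
  by apply: (swap_loop_leq k3 ib oddq); apply: eq_has_loop lq => x; apply: swap_permE.
by apply: eq_has_loop (swap_has_loop k3 ib) => x xN; rewrite swap_permE.
Qed.

Lemma loops_from_inverse k (p : 'S_(2 * k).+1) :
  loops_from k (perm_nat p) -> loops_from k (perm_nat (inverse_perm p)).
Proof.
case=> lo ex; split=> [q oddq /has_loop_inverse|]; first exact: lo.
by apply: has_loop_inverse; rewrite inverse_permK.
Qed.

Lemma types_cyclic k p : 3 <= k -> p \in types k -> cyclic_perm p.
Proof. by move=> k3 /(typesP _ k3)[b [i [ib ->]]]; apply: swap_perm_cyclic. Qed.

Section SecondMinimal.
Import numFieldNormedType.Exports.
Variables (R : realType) (k : nat).
Hypothesis k3 : 3 <= k.
Implicit Types (f : R -> R) (b : 'I_(2 * k).+1 -> R) (p : 'S_(2 * k).+1).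

Let N0 : 0 < 2 * k.
Proof. by lia. Qed.

(** Such a loop would give an odd period from 3 to [2 * k - 3] in the hull. *)
Lemma second_minimal_no_loop (I : set R) f b p : interval_map I f -> (forall i, I (b i)) ->
  second_minimal f b -> has_perm f b p -> ~ has_loop (edge (2 * k) (perm_nat p)) (2 * k - 3).
Proof.
move=> [itvI _ cf _] Ib [orb _ none] fbp loop.
have b_incr : increasing_points b by case: orb.
have sub : (hull b `<=` I)%classic.
  move=> x; rewrite /hull /= in_itv /= => xb.
  exact: itvI (Ib ord0) (Ib ord_max) _ xb.
have cp := orbit_cyclic b_incr orb fbp.
have oddq : odd (2 * k - 3) by lia.
have [d [oddd /andP[d1 dq] od]] :=
  loop_has_orbit N0 b_incr (continuous_subspaceW sub cf) fbp cp oddq loop.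
by apply: none od; rewrite // d1; lia.
Qed.

(** A smaller odd period would give a shorter odd loop by [orbit_loop]. The loop of length
    [2 * k - 1] gives an odd period at most that, hence equal to it. *)
Lemma P_linearization_second_minimal f b p : increasing_points b -> has_perm f b p ->
  cyclic_perm p -> loops_from k (perm_nat p) -> second_minimal (P_linearization f b) b.
Proof.
move=> b_incr fbp cp [lo ex].
have gbp : has_perm (P_linearization f b) b p.
  move=> i; have := P_linearization_point N0 b_incr fbp (_ : i <= 2 * k).
  by rewrite /point perm_nat_val !inord_val; apply; rewrite -ltnS.
have [_ _ cg _] := P_linearization_interval_map N0 b_incr fbp.
have no q : odd q -> 1 < q < 2 * k - 1 -> ~ has_orbit_in (P_linearization f b) (hull b) q.
  move=> oddq q1 oq; have := lo q oddq; rewrite leqNgt; have [_ ->] := andP q1.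
  move=> /(_ _)/negP; apply=> //.
  by apply: (orbit_loop N0 b_incr fbp cp oddq _ oq); lia.
split=> //; first exact: cyclic_is_orbit cp gbp.
have oddN : odd (2 * k - 1) by lia.
have [d [oddd /andP[d1 dq] od]] := loop_has_orbit N0 b_incr cg gbp cp oddN ex.
have [<- //|ne] := eqVneq d (2 * k - 1).
by case: (no d oddd) => //; rewrite d1; lia.
Qed.
End SecondMinimal.

Theorem theorem1p13 (R : realType) (k : nat) (hk : (3 <= k)%N) :
  exists T : {set 'S_(2 * k).+1},
    (#|T| = 4 * k - 3)%N /\
    (forall p, p \in T -> cyclic_perm p) /\
    stefan_perm k \notin T /\
    {in T &, injective (@digraph (2 * k))} /\
    (* (a) *)
    (forall (I : set R) (f : R -> R) (b : 'I_(2 * k).+1 -> R),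
       interval_map I f -> (forall i, I (b i)) ->
       second_minimal f b -> simple_pos f b ->
       exists p, has_perm f b p /\ (p = stefan_perm k \/ p \in T)) /\
    (* (b) *)
    (forall (I : set R) (f : R -> R) (b : 'I_(2 * k).+1 -> R),
       interval_map I f -> (forall i, I (b i)) ->
       second_minimal f b -> simple_neg f b ->
       exists p, has_perm f b (inverse_perm p) /\
                 (p = stefan_perm k \/ p \in T)) /\
    (* (c) *)
    (forall p, p \in T ->
       forall (f : R -> R) (b : 'I_(2 * k).+1 -> R),
         is_orbit f b -> has_perm f b p -> simple_pos f b) /\
    (count_structure R T [:: Max] = 1)%N /\
    (count_structure R T [:: Min; Max] = 1)%N /\
    (count_structure R T [:: Min; Max; Min] = 1)%N /\
    (count_structure R T [:: Max; Min] = 2)%N /\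
    (count_structure R T [:: Max; Min; Max] = 2 * k - 3)%N /\
    (count_structure R T [:: Max; Min; Max; Min; Max] = 2 * k - 5)%N /\
    (forall p, p \in T -> forall s : seq extremum_kind,
       topological_structure R p s ->
       (* order reversal also reverses the left-to-right reading *)
       topological_structure R (inverse_perm p)
         (rev (map swap_kind s))) /\
    (* (d) *)
    (forall p, p \in T ->
       forall p', p' = p \/ p' = inverse_perm p ->
       forall (f : R -> R) (b : 'I_(2 * k).+1 -> R),
         is_orbit f b -> has_perm f b p' ->
         interval_map (hull b) (P_linearization f b) /\
         second_minimal (P_linearization f b) b).
Proof.
have N0 : 0 < 2 * k by lia.
exists (types k); split; first exact: card_types.
split; first by move=> p; exact: types_cyclic.
split; first exact: stefan_types.
split; first by move=> p q _ _; apply: digraph_inj; lia.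
split.
  move=> I f b If Ib sm sp; have orb : is_orbit f b by case: sm.
  have b_incr : increasing_points b by case: orb.
  have [p fbp] := orbit_has_perm b_incr orb; exists p; split=> //.
  have [e pe] := (simple_posP b_incr fbp).1 sp.
  apply: simple_classification pe _ => //; first exact: orbit_cyclic orb fbp.
  exact: second_minimal_no_loop If Ib sm fbp.
split.
  move=> I f b If Ib sm sp; have orb : is_orbit f b by case: sm.
  have b_incr : increasing_points b by case: orb.
  (* Type - is reduced to type + by passing to the inverse, whose loops mirror those of [p]. *)
  have [p fbp] := orbit_has_perm b_incr orb; exists (inverse_perm p).
  split; first by rewrite inverse_permK.
  have [e pe] := simple_neg_inverse b_incr fbp sp.
  apply: simple_classification pe _ => //.
    exact/inverse_cyclic/(orbit_cyclic b_incr orb fbp).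
  by move=> /has_loop_inverse; exact: (second_minimal_no_loop hk If Ib sm fbp).
split.
  move=> p pT f b [b_incr _] fbp; apply/(simple_posP b_incr fbp).
  exact: types_simple.
rewrite !count_structureE // count_max // count_min_max // count_min_max_min //.
rewrite count_max_min // count_max_min_max // count_max_min_max_min_max //.
do 6! split=> //.
split.
  move=> p _ s /(topological_structureE _ _ _ N0) <-.
  by apply/(topological_structureE _ _ _ N0); rewrite perm_turns_inverse.
move=> p pT p' p'E f b [b_incr _] fbp.
have [cp' lp'] : cyclic_perm p' /\ loops_from k (perm_nat p').
  have cp := types_cyclic hk pT; have lp := types_loops hk pT.
  by case: p'E => ->; split=> //; [apply: inverse_cyclic|apply: loops_from_inverse].
split; first exact: (P_linearization_interval_map N0 b_incr fbp).
exact: (P_linearization_second_minimal hk b_incr fbp cp' lp').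
Qed.
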